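(* Let $e\geq 2$ be an integer. Assume that the following statement (C) is true. (C) For every integer $d\geq 1$, every $m\geq 0$, every $X\in\mathcal{P}^m$ and every odd $k\in\mathbb{N}$, if $$(X_1,X_2)=\Psi_{(d,(m,m+kd))}\circ\cdots\circ\Psi_{(d,(m,m+d))}\circ\Psi_{(d,(m,m))}(X,X)\in\mathcal{P}^m\times\mathcal{P}^{m+(k+1)d},$$ then $X_1\subset X_2$. Then for every $e$-regular partition $\lambda$ and every $k\in\mathbb{Z}_{>0}$, $$\psi_{(2e,(0,(2k+1)e))}\circ\cdots\circ\psi_{(2e,(0,3e))}\circ\psi_{(2e,(0,e))}(\lambda,\lambda)=\psi_{(e,(0,(2k+1)e))}\circ\cdots\circ\psi_{(e,(0,e))}\circ\psi_{(e,(0,0))}(\lambda,\lambda),$$ where on the left the second entries of the bicharges are $e,3e,5e,\ldots,(2k+1)e$ and on the right they are $0,e,2e,\ldots,(2k+1)e$. In particular, $$\widetilde{\psi}_{(2e,(0,e))}(\lambda,\lambda)=\widetilde{\psi}_{(e,(0,0))}(\lambda,\lambda).$$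
   Context: **Partitions.** A partition is a non-increasing sequence of nonnegative integers (trailing zeros are ignored); its rank is the sum of its parts; $\emptyset$ is the empty partition. For an integer $d\ge 2$, a partition is $d$-regular if no nonzero part is repeated $d$ or more times. A bipartition of $n$ is a pair $\boldsymbol{\lambda}=(\lambda^1,\lambda^2)$ of partitions with $|\lambda^1|+|\lambda^2|=n$ ($n$ is its rank). Its Young diagram is $\{(a,b,c): a\ge 1,\ c\in\{1,2\},\ 1\le b\le\lambda^c_a\}$. **Level 2 Kashiwara operators.** Fix an integer $d\ge 2$ and a bicharge $\mathbf{s}=(s_1,s_2)\in\mathbb{Z}^2$. The content of a node $\gamma=(a,b,c)$ is $b-a+s_c$, and its residue is its content modulo $d$. A node of $\boldsymbol\lambda$ is removable if deleting it from the diagram gives the diagram of a bipartition; a node not in the diagram is addable if adding it gives the diagram of a bipartition. For $i\in\mathbb{Z}$, an $i$-node is a node of residue $i+d\mathbb{Z}$. For two addable or removable $i$-nodes $\gamma=(a,b,c)$, $\gamma'=(a',b',c')$ of $\boldsymbol\lambda$, write $\gamma\prec_{\mathbf{s}}\gamma'$ if $b-a+s_c<b'-a'+s_{c'}$, or if $b-a+s_c=b'-a'+s_{c'}$ and $c>c'$. Write all addable and removable $i$-nodes of $\boldsymbol{\lambda}$ in increasing order for $\prec_{\mathbf s}$, encoding addable nodes by $A$ and removable nodes by $R$, and delete factors $RA$ recursively as long as possible, to obtain a word $A^pR^q$. If $p>0$, the node of the rightmost remaining $A$ is the good addable $i$-node; if $q>0$, the node of the leftmost remaining $R$ is the good removable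 $i$-node. Then $\widetilde{f}^{\mathbf{s}}_{i+d\mathbb{Z},d}\boldsymbol\lambda$ is obtained by adding the good addable $i$-node (it is $0$ if there is none), and $\widetilde{e}^{\mathbf{s}}_{i+d\mathbb{Z},d}\boldsymbol\lambda$ by removing the good removable $i$-node (it is $0$ if there is none). **Uglov bipartitions.** $\Phi_{(d,\mathbf{s})}$ is the set of bipartitions of the form $\widetilde{f}^{\mathbf s}_{i_1+d\mathbb{Z},d}\cdots\widetilde{f}^{\mathbf s}_{i_n+d\mathbb{Z},d}(\emptyset,\emptyset)$ with $n\ge 0$, $(i_1,\dots,i_n)\in\mathbb{Z}^n$; $\Phi_{(d,\mathbf{s})}(n)$ is its subset of bipartitions of rank $n$. For $\lambda$ $e$-regular one has $(\lambda,\lambda)\in\Phi_{(e,(0,0))}\cap\Phi_{(2e,(0,e))}$. **Crystal isomorphisms.** $\psi_{(d,(s_1,s_2))}:\Phi_{(d,(s_1,s_2))}\to\Phi_{(d,(s_1,s_2+d))}$ is the unique bijection (known to exist) that preserves rank and commutes with the Kashiwara operators: $\psi(\widetilde{f}^{(s_1,s_2)}_{i+d\mathbb{Z},d}\boldsymbol\lambda)=\widetilde{f}^{(s_1,s_2+d)}_{i+d\mathbb{Z},d}\psi(\boldsymbol\lambda)$ and similarly for $\widetilde{e}$, with the convention $\psi(0)=0$. **The map $\widetilde\psi$.** Let $s_1\le s_2$. For each $n$, the restriction of $\psi_{(d,(s_1,t))}$ to $\Phi_{(d,(s_1,t))}(n)$ is the identity as soon as $t-s_1>n-1$. For $\boldsymbol\lambda\in\Phi_{(d,(s_1,s_2))}(n)$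 one sets $$\widetilde{\psi}_{(d,(s_1,s_2))}(\boldsymbol\lambda)=\psi_{(d,(s_1,s_2+(k-1)d))}\circ\cdots\circ\psi_{(d,(s_1,s_2+d))}\circ\psi_{(d,(s_1,s_2))}(\boldsymbol\lambda)$$ for $k$ sufficiently large (the result does not depend on the large $k$ chosen). **The combinatorial maps $\Psi$.** For $r\ge 0$, $\mathcal{P}^r$ is the set of strictly increasing sequences of $r$ nonnegative integers, identified with $r$-element subsets of $\mathbb{Z}_{\ge 0}$. Let $d\ge 1$ and $0\le m_1\le m_2$. For $X_1=\{a_1<\cdots<a_{m_1}\}\in\mathcal{P}^{m_1}$ and $X_2\in\mathcal{P}^{m_2}$, define an injection $\varphi:X_1\to X_2$ by treating $a_1,a_2,\dots,a_{m_1}$ successively: $\varphi(a_j)$ is the largest element $b$ of $X_2\setminus\{\varphi(a_1),\dots,\varphi(a_{j-1})\}$ with $b\le a_j$ if such an element exists, and otherwise is the largest element of $X_2\setminus\{\varphi(a_1),\dots,\varphi(a_{j-1})\}$. Then $\Psi_{(d,(m_1,m_2))}:\mathcal{P}^{m_1}\times\mathcal{P}^{m_2}\to\mathcal{P}^{m_1}\times\mathcal{P}^{m_2+d}$ sends $(X_1,X_2)$ to $(Y_1,Y_2)$ with $$Y_1=\varphi(X_1),\qquad Y_2=\{a+d: a\in X_1\}\cup\{b+d: b\in X_2\setminus Y_1\}\cup\{0,1,\dots,d-1\}.$$ *)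

(* Defs.v *)
From mathcomp Require Import all_boot all_order all_algebra.
From mathcomp Require Import classical_sets functions.

Set Implicit Arguments.
Unset Strict Implicit.
Unset Printing Implicit Defensive.

Import Order.TTheory GRing.Theory Num.Theory.

(** * Partitions and bipartitions *)

(* Trailing zeros being ignored, a partition is represented by the sequence of
   its nonzero parts, so that equality of partitions is Leibniz equality. *)
Definition is_part (la : seq nat) : bool := sorted geq la && (0 \notin la).

Definition d_regular (d : nat) (la : seq nat) : bool :=
  all (fun x => count_mem x la < d) la.

Definition bipart : Type := (seq nat * seq nat)%type.

Definition empty_bipart : bipart := ([::], [::]).

Definition rank (la : bipart) : nat := sumn la.1 + sumn la.2.

(** * Nodes *)

(* A node (a, b, c) is in row a >= 1 and column b >= 1 of component
   c \in {1, 2}, encoded as a pair ((a, b), c). *)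
Definition node : Type := (nat * nat * nat)%type.

Definition component (la : bipart) (c : nat) : seq nat :=
  if c == 1 then la.1 else la.2.

Definition set_component (la : bipart) (c : nat) (mu : seq nat) : bipart :=
  if c == 1 then (mu, la.2) else (la.1, mu).

Definition row (la : bipart) (a c : nat) : nat := nth 0 (component la c) a.-1.

Definition decr_nth (la : seq nat) (i : nat) : seq nat :=
  set_nth 0 la i (nth 0 la i).-1.

Definition trim (la : seq nat) : seq nat := [seq x <- la | 0 < x].

(* Since rows are left-justified, a node of row a whose addition (deletion)
   gives a Young diagram lies in column row + 1 (in column row); the new
   diagram is that of a bipartition iff its row lengths, possibly followed by
   zeros, are non-increasing. *)
Definition addable (la : bipart) (g : node) : bool :=
  let: (a, b, c) := g in
  [&& 0 < a, c \in [:: 1; 2], b == (row la a c).+1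
    & sorted geq (incr_nth (component la c) a.-1)].

Definition removable (la : bipart) (g : node) : bool :=
  let: (a, b, c) := g in
  [&& 0 < a, c \in [:: 1; 2], 0 < b, b == row la a c
    & sorted geq (decr_nth (component la c) a.-1)].

Definition add_node (la : bipart) (g : node) : bipart :=
  let: (a, b, c) := g in
  set_component la c (incr_nth (component la c) a.-1).

Definition remove_node (la : bipart) (g : node) : bipart :=
  let: (a, b, c) := g in
  set_component la c (trim (decr_nth (component la c) a.-1)).

Definition charge (s : int * int) (c : nat) : int := if c == 1 then s.1 else s.2.

Definition content (s : int * int) (g : node) : int :=
  let: (a, b, c) := g in (b%:Z - a%:Z + charge s c)%R.

Definition is_inode (d : nat) (s : int * int) (i : int) (g : node) : bool :=
  (content s g == i %[mod d%:Z])%Z.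

Definition prec (s : int * int) (g g' : node) : bool :=
  (content s g < content s g')%R
  || (content s g == content s g') && (g'.2 < g.2).

(** * Kashiwara operators *)

Definition addable_nodes (la : bipart) : seq node :=
  [seq g <- [seq (a, (row la a c).+1, c) |
               c <- [:: 1; 2], a <- iota 1 (size (component la c)).+1]
   | addable la g].

Definition removable_nodes (la : bipart) : seq node :=
  [seq g <- [seq (a, row la a c, c) |
               c <- [:: 1; 2], a <- iota 1 (size (component la c))]
   | removable la g].

(* Two distinct addable or removable nodes of a bipartition are never
   equivalent for [prec], so sorting with its reflexive closure
   [~~ prec s g' g] gives the increasing order. *)
Definition inode_word (d : nat) (s : int * int) (i : int) (la : bipart) :
    seq node :=
  sort (fun g g' => ~~ prec s g' g)
       [seq g <- addable_nodes la ++ removable_nodes la | is_inode d s i g].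

(* Prepend a node to a word without factor RA, deleting the factor RA that may
   appear at the front. *)
Definition cons_cancel (la : bipart) (g : node) (w : seq node) : seq node :=
  if w is g' :: w' then
    if removable la g && addable la g' then w' else g :: w
  else [:: g].

Definition reduced_word (d : nat) (s : int * int) (i : int) (la : bipart) :
    seq node :=
  foldr (cons_cancel la) [::] (inode_word d s i la).

Definition good_addable (d : nat) (s : int * int) (i : int) (la : bipart) :
    option node :=
  ohead (rev [seq g <- reduced_word d s i la | addable la g]).

Definition good_removable (d : nat) (s : int * int) (i : int) (la : bipart) :
    option node :=
  ohead [seq g <- reduced_word d s i la | removable la g].

(* The value 0 of the operators is encoded by None. *)
Definition ftilde (d : nat) (s : int * int) (i : int) (la : bipart) :
    option bipart :=
  omap (add_node la) (good_addable d s i la).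

Definition etilde (d : nat) (s : int * int) (i : int) (la : bipart) :
    option bipart :=
  omap (remove_node la) (good_removable d s i la).

(** * Uglov bipartitions and crystal isomorphisms *)

Definition Phi (d : nat) (s : int * int) : set bipart :=
  fun la => exists w : seq int,
    foldr (fun i => obind (ftilde d s i)) (Some empty_bipart) w = Some la.

(* The values of psi outside Phi d s are irrelevant. *)
Definition crystal_iso (d : nat) (s : int * int) (psi : bipart -> bipart) :
    Prop :=
  let s' := (s.1, s.2 + d%:Z)%R in
  [/\ set_bij (Phi d s) (Phi d s') psi,
      forall la, Phi d s la -> rank (psi la) = rank la,
      forall i la, Phi d s la ->
        omap psi (ftilde d s i la) = ftilde d s' i (psi la)
    & forall i la, Phi d s la ->
        omap psi (etilde d s i la) = etilde d s' i (psi la)].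

(* psi_(d,(s1,s2+(k-1)d)) o ... o psi_(d,(s1,s2+d)) o psi_(d,(s1,s2)) *)
Fixpoint psi_comp (psi : nat -> int * int -> bipart -> bipart)
    (d : nat) (s : int * int) (k : nat) (la : bipart) : bipart :=
  if k is k'.+1 then
    psi d (s.1, s.2 + (k' * d)%:Z)%R (psi_comp psi d s k' la)
  else la.

(* mu is the common value of the compositions for all large k. *)
Definition is_psi_tilde (psi : nat -> int * int -> bipart -> bipart)
    (d : nat) (s : int * int) (la mu : bipart) : Prop :=
  exists K, forall k, K <= k -> psi_comp psi d s k la = mu.

(** * The maps Psi *)

Definition in_P (r : nat) (X : seq nat) : bool := sorted ltn X && (size X == r).

Definition phi_pick (a : nat) (X : seq nat) : nat :=
  if has (fun b => b <= a) X then \max_(b <- X | b <= a) b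
  else \max_(b <- X) b.

(* The sequence phi(a_1), phi(a_2), ..., where X1 lists a_1 < a_2 < ... *)
Fixpoint phi_values (X1 X2 : seq nat) : seq nat :=
  if X1 is a :: X1' then
    let b := phi_pick a X2 in b :: phi_values X1' (rem b X2)
  else [::].

(* Psi_(d,(m1,m2)) only depends on m1 and m2 through its domain: m1 and m2 are
   the sizes of the two arguments. *)
Definition Psi (d : nat) (X : seq nat * seq nat) : seq nat * seq nat :=
  let Y1 := phi_values X.1 X.2 in
  (sort leq Y1,
   sort leq (undup ([seq a + d | a <- X.1]
                    ++ [seq b + d | b <- X.2 & b \notin Y1]
                    ++ iota 0 d))).

(* Main.v *)
Require Import Defs.
From mathcomp Require Import all_boot all_order all_algebra.
From mathcomp Require Import zify.

(* A bipartition with bicharge (0, s) is encoded by the beta sets X1, X2 of its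
   components, of sizes M and M + s for a large M; a node of content j is then
   a number j + M that can be lowered, or reached by raising j + M - 1.

   The injection phi is a cyclic matching, and its image Y is characterised by
   a counting condition: for some w, the number of elements >= v of Y is at most
   w plus that of X1, with equality at the elements of X2 outside Y. Since only
   one count changes when u is replaced by u + 1 in a beta set, a finite case
   analysis shows that Psi preserves the signature at every content and commutes
   with the sl_oo crystal operators; as the words of the Kashiwara operators are
   concatenations of those signatures, Psi commutes with ftilde and therefore
   computes psi on Uglov bipartitions.

   An e-regular partition la is obtained from the empty one by adding good nodes
   for the level 1 crystal. The i-word of (la, la) for (e, (0, 0)) is the level 1
   word with every letter doubled, and for (2e, (0, e)) it is the level 1 word
   itself, its nodes being read alternately in the two components; hence (la, la)
   is Uglov in both cases.

   If Psi_d (X1, X2) = (Y1, Y2) with Y1 included in Y2, the next map Psi_d fixes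
   Y1 and only shifts Y2, so that Psi_d o Psi_d = Psi_2d at (X1, X2). By (C) this
   applies to every second step, and at those steps psi_(e, _) is the identity. *)

Set Implicit Arguments.
Unset Strict Implicit.
Unset Printing Implicit Defensive.
Import Order.TTheory GRing.Theory Num.Theory.

(** * The matching of two sets *)

Lemma bigmax_mem_filter (P : pred nat) (X : seq nat) :
  has P X -> \max_(b <- X | P b) b \in filter P X.
Proof.
elim: X => [//|x X IHX] /=; rewrite big_cons.
case Px: (P x) => /=; last by move/IHX.
move=> _; rewrite inE; case: (boolP (has P X)) => [/IHX IH | nX].
  by case: leqP => _; rewrite ?IH ?orbT ?eqxx.
by rewrite big_hasC // maxn0 eqxx.
Qed.

Lemma phi_pick_mem (a : nat) (X : seq nat) : X != [::] -> phi_pick a X \in X.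
Proof.
move=> X0; rewrite /phi_pick; case: ifP => [/bigmax_mem_filter|_].
  by rewrite mem_filter => /andP[].
by have /bigmax_mem_filter : has predT X; [case: X X0 | rewrite mem_filter].
Qed.

(** If the pick is the largest element not exceeding [a], no element of [X] separates the two; if it
    wraps around, every element of [X] exceeds [a] and is at most the pick. The last summand thus
    records a wrap, as counted by [w] in [is_match]. *)
Lemma phi_pickP (a : nat) (X : seq nat) (v : nat) : X != [::] -> v \in X ->
  (v <= phi_pick a X) = (v <= a) + (a < phi_pick a X) :> nat.
Proof.
move=> X0 vX; have := phi_pick_mem a X0; rewrite /phi_pick.
case: ifP => [hX|nX].
  have := bigmax_mem_filter hX; rewrite mem_filter => /andP[ba _] bX.
  have hv : v <= a -> v <= \max_(b <- X | b <= a) b.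
    by move=> va; apply: leq_bigmax_seq.
  by move: hv ba; lia.
move=> bX; have hv : v <= \max_(b <- X) b by apply: leq_bigmax_seq.
have ga c : c \in X -> a < c.
  by move=> cX; rewrite ltnNge; apply/negP => ca; move/hasP: nX; apply; exists c.
by move: (ga _ vX) (ga _ bX) hv; lia.
Qed.

Definition tail (X : seq nat) (v : nat) : nat := count (leq v) X.

Lemma tailS (X : seq nat) (v : nat) :
  uniq X -> tail X v = tail X v.+1 + (v \in X).
Proof.
move=> uX; rewrite -count_uniq_mem // /tail.
by elim: X {uX} => //= x X ->; rewrite /=; lia.
Qed.

Lemma tail_eq0 (X : seq nat) : exists N, forall v, N <= v -> tail X v = 0.
Proof.
elim: X => [|x X [N IH]]; first by exists 0.
exists (maxn N x.+1) => v hv; rewrite /tail /= -/(tail X v) IH; lia.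
Qed.

(* Reading positions downwards as cars (X1) and parking places (X2) on a
   circle, [tail X1 v + w - tail Y v] is the number of cars still waiting at v
   and w the number of cars that pass from the bottom to the top: the places Y
   are those taken when no car passes a place that remains free. *)
Definition is_match (X1 X2 Y : seq nat) : Prop :=
  [/\ uniq Y, {subset Y <= X2}, size Y = size X1 &
   exists w, (forall v, tail Y v <= tail X1 v + w) /\
     (forall v, v \in X2 -> v \notin Y -> tail Y v = tail X1 v + w)].

Lemma phi_values_match (X1 X2 : seq nat) :
  uniq X2 -> size X1 <= size X2 -> is_match X1 X2 (phi_values X1 X2).
Proof.
elim: X1 X2 => [|a X1 IH] X2 uX2 sX.
  by split=> //; exists 0.
have X20 : X2 != [::] by case: X2 sX uX2.
have bX := phi_pick_mem a X20.
rewrite [phi_values _ _]/=; set b := phi_pick a X2 in bX *.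
have [|uY sY eY [w [w1 w2]]] := IH (rem b X2) (rem_uniq _ uX2).
  by rewrite size_rem //; case: (X2) sX.
split.
- rewrite /= uY andbT; apply/negP => /sY.
  by rewrite mem_rem_uniq // !inE eqxx.
- move=> v; rewrite inE => /orP[/eqP-> //|/sY].
  exact: mem_rem.
- by rewrite /= eY.
(* The number of wraps grows by one exactly when no element of [X2] is at most [a]. *)
exists (w + (a < b)); split=> v.
  by have := w1 v; rewrite /tail /= -/(tail _ _); lia.
move=> vX; rewrite inE negb_or => /andP[vb vY].
have := phi_pickP a X20 vX; rewrite -/b => hb.
have := w2 v; rewrite mem_rem_uniq // !inE vb => /(_ vX vY).
by rewrite /tail /= hb -/(tail _ _); lia.
Qed.

(** Let [w <= w']. The bound [key] descends from large [v]: it is at risk only at a [v] in [Y']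
    outside [Y], where the equality for [Y] and the inequality for [Y'] restore it. A [v] in [Y]
    outside [Y'] would make [key] an equality at [v] and violate it at [v.+1]. *)
Lemma match_unique (X1 X2 Y Y' : seq nat) :
  uniq X1 -> uniq X2 -> is_match X1 X2 Y -> is_match X1 X2 Y' -> Y =i Y'.
Proof.
move=> uX1 uX2 [uY sY eY [w [w1 w2]]] [uY' sY' eY' [w' [w1' w2']]].
wlog le_w : w w' Y Y' uY sY eY w1 w2 uY' sY' eY' w1' w2' / w <= w'.
  move=> H; case: (leqP w w') => h; first exact: (H w w').
  by move=> t; rewrite (H w' w Y' Y) // ltnW.
have key : forall v, w + tail Y' v <= w' + tail Y v.
  have [N hN] := tail_eq0 Y'.
  move=> v; move: {2}(N - v) (leqnn (N - v)) => k.
  elim: k v => [|k IHk] v hk; first by rewrite hN; lia.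
  have /IHk IH : N - v.+1 <= k by lia.
  have := tailS v uY; have := tailS v uY'; have := w1' v; have := w2 v.
  case vY' : (v \in Y'); case vY : (v \in Y) => /=; try lia.
  by move=> /(_ (sY' _ vY') isT); lia.
have sub : {subset Y <= Y'}.
  move=> v vY; apply/negPn/negP => vY'.
  have := w2' v (sY _ vY) vY'; have := tailS v uY'; have := tailS v uY.
  have := tailS v uX1; have := key v; have := key v.+1; have := w1 v; have := w1' v.+1.
  by rewrite vY (negbTE vY'); lia.
by apply: (uniq_min_size uY sub _).2; rewrite eY eY'.
Qed.

(** * Raising one element of a beta set *)

Definition mv (u : nat) (X : seq nat) : seq nat :=
  [seq if t == u then u.+1 else t | t <- X].

Lemma mv_notin (u : nat) (X : seq nat) : u \notin X -> mv u X = X.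
Proof.
move=> uX; rewrite /mv -[RHS]map_id; apply/eq_in_map => t tX.
by case: eqP => // e; rewrite -e tX in uX.
Qed.

Lemma mem_mv (u : nat) (X : seq nat) (t : nat) : u \in X ->
  (t \in mv u X) = (t != u) && ((t == u.+1) || (t \in X)).
Proof.
move=> uX; apply/mapP/andP => [[x xX ->]|[tu]].
  by case: (eqVneq x u) => [_|xu]; [split; [lia|rewrite eqxx] | rewrite xX orbT].
case/orP => [/eqP->|tX]; first by exists u; rewrite ?eqxx.
by exists t; rewrite ?(negbTE tu).
Qed.

Lemma size_mv (u : nat) (X : seq nat) : size (mv u X) = size X.
Proof. by rewrite size_map. Qed.

Lemma sorted_mv (u : nat) (X : seq nat) :
  u.+1 \notin X -> sorted ltn X -> sorted ltn (mv u X).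
Proof.
move=> uX sX; rewrite sorted_map.
apply: (@sub_in_sorted _ (mem X) ltn) => //.
move=> x y xX yX /=; have [yu xu] : y <> u.+1 /\ x <> u.+1.
  by split=> h; rewrite -h ?xX ?yX in uX.
by case: eqP; case: eqP => /=; lia.
Qed.

Lemma uniq_ltn (X : seq nat) : sorted ltn X -> uniq X.
Proof. exact: (sorted_uniq ltn_trans ltnn). Qed.

Lemma tail_mv (u : nat) (X : seq nat) (t : nat) : u \in X -> uniq X ->
  tail (mv u X) t = tail X t + (t == u.+1).
Proof.
elim: X => [//|x X IH] /= uX /andP[xX uqX]; move: uX xX.
rewrite /tail /= -/(tail (mv u X) t) -/(tail X t) inE.
case: (eqVneq x u) => [-> _ uX|xu]; last by move=> /= uX _; rewrite IH //; lia.
by rewrite mv_notin //; lia.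
Qed.

(* The letter at v of the word of a set of beta numbers: 1 if v - 1 can be
   replaced by v (addable node), -1 if v can be replaced by v - 1 (removable
   node). It is 0 at v = 0 because [0.-1 = 0]. *)
Definition letter (X : seq nat) (v : nat) : int :=
  ((v.-1 \in X)%:Z - (v \in X)%:Z)%R.

(* The letter of a two letter word on which the operator adding a node acts. *)
Definition act_fst (a b : int) : bool := (a == 1%R) && (b != 1%R).
Definition act_snd (a b : int) : bool := (b == 1%R) && (a != (-1)%R).

Lemma letter_values (X : seq nat) (v : nat) :
  [|| letter X v == 1, letter X v == 0 | letter X v == -1]%R.
Proof. by rewrite /letter; case: (_ \in _); case: (_ \in _). Qed.

Lemma act_fst_bool (a b c d : bool) :
  act_fst (a%:Z - b%:Z)%R (c%:Z - d%:Z)%R = [&& a, ~~ b & ~~ (c && ~~ d)].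
Proof. by case: a b c d => [] [] [] []. Qed.

Lemma act_snd_bool (a b c d : bool) :
  act_snd (a%:Z - b%:Z)%R (c%:Z - d%:Z)%R = [&& c, ~~ d & a || ~~ b].
Proof. by case: a b c d => [] [] [] []. Qed.

(** The largest partial sum of a two letter word, that is the exponent p of its reduction A^pR^q;
    together with the sum p - q of the letters it determines this reduction. *)
Definition height2 (a b : int) : int := Num.max 0%R (Num.max a (a + b)%R).

(** The letters are ordered as in the words: at equal content component 2 comes first, and [Z], once
    shifted by [d], is the second component of the image, read after [Y]. Sum and height say that
    both blocks have the same reduction. In the last two clauses, raising [u] in the set that
    carries the good letter either raises [u] in [Y] or leaves [Y] alone, so that [Z] changes
    instead. *)
Lemma match_local (X1 X2 Y Z : seq nat) (u : nat) :
  uniq X1 -> uniq X2 -> is_match X1 X2 Y ->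
  (forall t, (t \in Z) = (t \in X1) || (t \in X2) && (t \notin Y)) ->
  [/\ (letter X2 u.+1 + letter X1 u.+1 = letter Y u.+1 + letter Z u.+1)%R,
      height2 (letter X2 u.+1) (letter X1 u.+1)
      = height2 (letter Y u.+1) (letter Z u.+1),
      (act_fst (letter X2 u.+1) (letter X1 u.+1) ->
        act_fst (letter Y u.+1) (letter Z u.+1)
          /\ is_match X1 (mv u X2) (mv u Y)
        \/ act_snd (letter Y u.+1) (letter Z u.+1)
          /\ is_match X1 (mv u X2) Y)
    & (act_snd (letter X2 u.+1) (letter X1 u.+1) ->
        act_fst (letter Y u.+1) (letter Z u.+1)
          /\ is_match (mv u X1) X2 (mv u Y)
        \/ act_snd (letter Y u.+1) (letter Z u.+1)
          /\ is_match (mv u X1) X2 Y)].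
Proof.
move=> uX1 uX2 [uY sY eY [w [w1 w2]]] hZ; rewrite /letter /= !hZ.
have subY t : t \in Y -> t \in X2 := sY t.
have Y0 := w1 u; have Y1 := w1 u.+1; have Y2 := w1 u.+2.
have E0 := w2 u; have E1 := w2 u.+1.
have T0 := tailS u uX1; have T1 := tailS u.+1 uX1.
have S0 := tailS u uY; have S1 := tailS u.+1 uY.
have b0 := subY u; have b1 := subY u.+1.
have mX1 t : u \in X1 -> tail (mv u X1) t = tail X1 t + (t == u.+1).
  by move=> h; apply: tail_mv.
have mY t : u \in Y -> tail (mv u Y) t = tail Y t + (t == u.+1).
  by move=> h; apply: tail_mv.
have mvY : u \in Y -> u.+1 \notin Y -> uniq (mv u Y).
  move=> a b; rewrite map_inj_in_uniq // => x y xY yY.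
  case: (eqVneq x u) => [->|xu]; case: (eqVneq y u) => [->|yu] // h.
  - by rewrite h yY in b.
  - by rewrite -h xY in b.
split.
- by clear -b0 b1 E0 E1 T0 T1 S0 S1 Y0 Y1 Y2; move: b0 b1 E0 E1 T0 T1 S0 S1 Y0 Y1 Y2;
  case: (u \in X1); case: (u.+1 \in X1); case: (u \in X2); case: (u.+1 \in X2);
  case: (u \in Y); case: (u.+1 \in Y) => //=; lia.
- clear -b0 b1 E0 E1 T0 T1 S0 S1 Y0 Y1 Y2; move: b0 b1 E0 E1 T0 T1 S0 S1 Y0 Y1 Y2.
  case: (u \in X1); case: (u.+1 \in X1); case: (u \in X2); case: (u.+1 \in X2);
  case: (u \in Y); case: (u.+1 \in Y) => //=; lia.
- rewrite !act_fst_bool act_snd_bool => hA.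
  (* If [u] is in [Y], it has to move along with [X2], and the strict inequality leaves room for the
     increase of [tail Y u.+1]. Otherwise the free place moves from [u] to [u.+1], where equality is
     then required. *)
  have [[A [uY1 [uY2 lt]]]|[A [uY1 [uX eq]]]] :
    ([&& u \in Y, u.+1 \notin Y & ~~ (((u \in X1) || (u \in X2) && (u \notin Y)) &&
      ~~ ((u.+1 \in X1) || (u.+1 \in X2) && (u.+1 \notin Y)))] /\
     (u \in Y /\ (u.+1 \notin Y /\ tail Y u.+1 < tail X1 u.+1 + w))) \/
    ([&& ((u \in X1) || (u \in X2) && (u \notin Y)),
      ~~ ((u.+1 \in X1) || (u.+1 \in X2) && (u.+1 \notin Y)) & (u \in Y)
      || (u.+1 \notin Y)] /\
     (u \notin Y /\ (u \in X2 /\ tail Y u.+1 = tail X1 u.+1 + w))).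
    case/and3P: hA (b1) E0 S0 S1 T0 T1 Y0 Y1 Y2 => -> /negbTE-> hA nY; clear -hA nY.
    have {nY}-> : u.+1 \in Y = false by apply/negP => /nY.
    move: hA; case: (u \in X1); case: (u.+1 \in X1) => //=;
    case: (u \in Y) => //=; intros; first [left; do !split=> //; lia|right;
      do !split=> //; lia|exfalso; lia].
  + left; split=> //; have uX := subY _ uY1; split; rewrite ?size_mv //;
    first exact: mvY.
      by move=> t; rewrite !mem_mv // => /andP[-> /orP[->|/subY->]]; rewrite ?orbT.
    exists w; split=> v.
      by rewrite mY //; case: eqP => [->|_] /=; rewrite ?addn0 ?addn1.
    rewrite mY // !mem_mv //; case: (eqVneq v u) => //= _.
    by case: eqP => //= _ vX vY; rewrite addn0; apply: w2.
  + right; split=> //; split=> //.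
      move=> t tY; rewrite mem_mv // (subY _ tY) orbT andbT.
      by apply: contraNneq uY1 => <-.
    exists w; split=> // v; rewrite mem_mv // => /andP[_ /orP[/eqP->//|]].
    exact: w2.
- rewrite act_fst_bool !act_snd_bool => hA.
  (* Moving [u] in [X1] raises the count at [u.+1] only. Either [Y] follows, which frees the place
     [u], or [Y] stays, which requires that [u.+1] not be a free place. *)
  have [[A [uY1 [uY2 [uX [uX' eq]]]]]|[A [uX uY1]]] :
    ([&& u \in Y, u.+1 \notin Y & ~~ (((u \in X1) || (u \in X2) && (u \notin Y)) &&
      ~~ ((u.+1 \in X1) || (u.+1 \in X2) && (u.+1 \notin Y)))] /\
     (u \in Y /\ (u.+1 \notin Y /\ (u \in X1 /\ (u.+1 \in X2
       /\ tail Y u = tail X1 u + w))))) \/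
    ([&& ((u \in X1) || (u \in X2) && (u \notin Y)),
      ~~ ((u.+1 \in X1) || (u.+1 \in X2) && (u.+1 \notin Y)) & (u \in Y)
      || (u.+1 \notin Y)] /\
     (u \in X1 /\ (u.+1 \in X2 -> u.+1 \in Y))).
    case/and3P: hA b0 b1 E0 E1 S0 S1 T0 T1 Y0 Y1 Y2 => -> /negbTE-> hA; clear -hA.
    move: hA; case: (u \in X2); case: (u.+1 \in X2) => //=;
    case: (u \in Y); case: (u.+1 \in Y) => //=; intros; try by [lia | exfalso; auto];
      first [left; do !split=> //; lia|right; do !split=> //; lia|exfalso; lia].
  + left; split=> //; split; rewrite ?size_mv //; first exact: mvY.
      by move=> t; rewrite mem_mv // => /andP[_ /orP[/eqP->//|/subY]].
    exists w; split=> v.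
      by rewrite mY // mX1 //; have := w1 v; clear; lia.
    rewrite mY // mX1 // mem_mv //; case: (eqVneq v u) => [->|vu] /=.
      by move: eq; clear; lia.
    by case: eqP => //= _ vX vY; rewrite !addn0; apply: w2.
  + right; split=> //; split=> //; rewrite ?size_mv //.
    exists w; split=> v; first by rewrite mX1 //; have := w1 v; clear; lia.
    rewrite mX1 //; case: eqP => [->|_]; first by move=> /uY1->.
    by rewrite addn0; apply: w2.
Qed.

(** * Compatibility of Psi with the crystal operators *)

(** The graph of [Psi d], freed from the order in which elements are matched, so that it can be
    checked again after a move. The truncated [t - d] only matters once [t < d] fails. *)
Definition is_Psi (d : nat) (X1 X2 Y W : seq nat) : Prop :=
  [/\ sorted ltn Y, sorted ltn W, is_match X1 X2 Y &
   forall t, (t \in W) = (t < d) || (t - d \in X1)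
                         || (t - d \in X2) && (t - d \notin Y)].

Lemma match_perm (X1 X2 Y Y' : seq nat) :
  perm_eq Y Y' -> is_match X1 X2 Y -> is_match X1 X2 Y'.
Proof.
move=> pY [uY sY eY [w [w1 w2]]]; split.
- by rewrite -(perm_uniq pY).
- by move=> t; rewrite -(perm_mem pY); apply: sY.
- by rewrite -(perm_size pY).
exists w; split=> v; rewrite /tail -(permP pY); first exact: w1.
by rewrite -(perm_mem pY); apply: w2.
Qed.

Lemma sort_leq_ltn (s : seq nat) : uniq s -> sorted ltn (sort leq s).
Proof.
by move=> us; rewrite ltn_sorted_uniq_leq sort_uniq us sort_sorted //; apply: leq_total.
Qed.

Lemma sorted_ltn_eq (s t : seq nat) :
  sorted ltn s -> sorted ltn t -> s =i t -> s = t.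
Proof. exact: (irr_sorted_eq ltn_trans ltnn). Qed.

Lemma mem_map_addn (d : nat) (X : seq nat) (t : nat) :
  (t \in [seq a + d | a <- X]) = (d <= t) && (t - d \in X).
Proof.
apply/mapP/andP => [[x xX ->]|[dt tX]]; first by rewrite leq_addl addnK.
by exists (t - d) => //; rewrite subnK.
Qed.

Lemma PsiP (d : nat) (X1 X2 : seq nat) : uniq X2 -> size X1 <= size X2 ->
  is_Psi d X1 X2 (Psi d (X1, X2)).1 (Psi d (X1, X2)).2.
Proof.
move=> uX2 sX; have hm := phi_values_match uX2 sX.
have [uY _ _ _] := hm.
split=> /=; rewrite ?sort_leq_ltn ?undup_uniq //.
  by apply: match_perm hm; rewrite perm_sym perm_sort.
move=> t; rewrite mem_sort mem_undup !mem_cat !mem_map_addn mem_filter mem_iota.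
by rewrite mem_sort /= add0n andbC; case: ltnP => /= [|_];
  rewrite ?orbT ?orbF // andbT [X in _ || X]andbC.
Qed.

Lemma is_Psi_eq (d : nat) (X1 X2 Y W : seq nat) :
  sorted ltn X1 -> sorted ltn X2 -> size X1 <= size X2 ->
  is_Psi d X1 X2 Y W -> Psi d (X1, X2) = (Y, W).
Proof.
move=> /uniq_ltn u1 /uniq_ltn u2 sX [sY sW mY hW].
have [sY' sW' mY' hW'] := PsiP d u2 sX.
rewrite [LHS]surjective_pairing.
have eY := match_unique u1 u2 mY' mY.
rewrite (sorted_ltn_eq sY' sY eY); congr pair; apply: sorted_ltn_eq => // t.
by rewrite hW hW' eY.
Qed.

(** Were [t] a free place, the equality at [t], together with the element [t] of [X1], would break
    the inequality at [t.+1]. *)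
Lemma match_common (X1 X2 Y : seq nat) (t : nat) :
  uniq X1 -> is_match X1 X2 Y -> t \in X1 -> t \in X2 -> t \in Y.
Proof.
move=> uX1 [uY _ _ [w [w1 w2]]] t1 t2; apply/negPn/negP => tY.
move: (tailS t uX1) (tailS t uY) (w1 t.+1) (w2 _ t2 tY).
by rewrite t1 (negbTE tY); clear; lia.
Qed.

(** At [v = 0] both [d.-1] and [d] lie in [W], the latter because [0 \in X1]; this agrees with the
    value 0 of a letter at 0. *)
Lemma letterW (d : nat) (X1 X2 Y W : seq nat) (v : nat) :
  0 \in X1 -> is_Psi d X1 X2 Y W ->
  letter W (v + d)
  = letter [seq t <- X1 ++ X2 | (t \in X1) || (t \notin Y)] v.
Proof.
move=> X10 [_ _ _ hW]; rewrite /letter !hW !mem_filter !mem_cat.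
case: v => [|v] /=.
  rewrite add0n subnn X10 /= orbT subrr; case: d {hW} => [|d] /=; first by rewrite X10.
  by rewrite ltnSn.
rewrite addSn /= -addSn !addnK !ltnNge !leq_addl /=.
by do 2!case: (_ \in X1); do 2!case: (_ \in X2); do 2!case: (_ \in Y).
Qed.

(** This is [match_local] with [Z] replaced by [W], its shift by [d] completed by the interval below
    [d]; a move of [u] in [Z] becomes a move of [u + d] in [W]. *)
Lemma Psi_local (d : nat) (X1 X2 Y W : seq nat) (u : nat) :
  uniq X1 -> uniq X2 -> 0 \in X1 -> is_Psi d X1 X2 Y W ->
  let a := letter X2 u.+1 in let b := letter X1 u.+1 in
  let a' := letter Y u.+1 in let b' := letter W (u.+1 + d) in
  [/\ (a + b = a' + b')%R, height2 a b = height2 a' b',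
      (act_fst a b ->
        act_fst a' b' /\ is_Psi d X1 (mv u X2) (mv u Y) W
        \/ act_snd a' b' /\ is_Psi d X1 (mv u X2) Y (mv (u + d) W))
    & (act_snd a b ->
        act_fst a' b' /\ is_Psi d (mv u X1) X2 (mv u Y) W
        \/ act_snd a' b' /\ is_Psi d (mv u X1) X2 Y (mv (u + d) W))].
Proof.
move=> uX1 uX2 X10 hP /=; rewrite (letterW _ X10 hP).
set Z := [seq t <- _ | _].
have hZ t : (t \in Z) = (t \in X1) || (t \in X2) && (t \notin Y).
  by rewrite mem_filter mem_cat; case: (_ \in X1); case: (_ \in X2); case: (_ \in Y).
have [sY sW mY hW] := hP.
have [e1 e2 h1 h2] := match_local u uX1 uX2 mY hZ.
have subY : {subset Y <= X2} by case: mY.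
have W_Z t : (t + d \in W) = (t \in Z).
  by rewrite hW addnK hZ ltnNge leq_addl.
have b0 := subY u; have b1 := subY u.+1.
split=> //.
- move=> hA; case: (h1 hA) => [[hA' hm]|[hA' hm]]; [left|right]; split=> //.
  + split=> //.
      by apply: sorted_mv => //; move: hA'; rewrite act_fst_bool => /and3P[].
    move=> t; rewrite hW; case: ltnP => //= td.
    move: hA hA'; rewrite !act_fst_bool !hZ => hA hA'.
    have uX : u \in X2 by case/and3P: hA.
    have uY : u \in Y by case/and3P: hA'.
    rewrite !mem_mv //.
    case: (eqVneq (t - d) u) => [->|tu] /=; first by rewrite uY uX.
    case: (eqVneq (t - d) u.+1) => [->|tu'] //=.
    by case/and3P: hA => _ /negbTE->.
  + move: hA hA'; rewrite !act_fst_bool !act_snd_bool !hZ => hA hA'.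
    have uX : u \in X2 by case/and3P: hA.
    have uW : u + d \in W by rewrite W_Z hZ; case/and3P: hA'.
    have uW' : (u + d).+1 \notin W by rewrite -addSn W_Z hZ; case/and3P: hA'.
    split=> //; first exact: sorted_mv.
    move=> t; rewrite (mem_mv t uW) hW.
    case: ltnP => /= td.
      have tu : t != u + d by rewrite neq_ltn (leq_trans td (leq_addl _ _)).
      by rewrite tu orbT.
    rewrite -(subnK td) !addnK eqn_add2r -addSn eqn_add2r (mem_mv _ uX).
    move: hA hA' b0 b1; case: (eqVneq (t - d) u) => [->|tu] /=.
      by move=> /and3P[_ _ +] /and3P[_ + _] _ _; case: (u \in X1); case: (u.+1 \in X1).
    case: (eqVneq (t - d) u.+1) => [->|tu'] //=.
    case/and3P=> _ /negbTE-> _ _ _ nY.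
    have -> : u.+1 \in Y = false by apply/negP => /nY.
    by rewrite orbT.
- move=> hA; case: (h2 hA) => [[hA' hm]|[hA' hm]]; [left|right]; split=> //.
  + split=> //.
      by apply: sorted_mv => //; move: hA'; rewrite act_fst_bool => /and3P[].
    move=> t; rewrite hW; case: ltnP => //= td.
    move: hA hA'; rewrite !act_fst_bool !act_snd_bool !hZ => hA hA'.
    have uX : u \in X1 by case/and3P: hA.
    have uY : u \in Y by case/and3P: hA'.
    rewrite !mem_mv //.
    case: (eqVneq (t - d) u) => [->|tu] /=; first by move: hA';
      rewrite uX uY (subY _ uY); case/and3P.
    case: (eqVneq (t - d) u.+1) => [->|tu'] //=.
    move: hA'; case/and3P: hA => _ /negbTE-> _ /and3P[_ /negbTE->].
    by rewrite uX /=; case: (u.+1 \in X2).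
  + move: hA hA'; rewrite !act_snd_bool !hZ => hA hA'.
    have uX : u \in X1 by case/and3P: hA.
    have uW : u + d \in W by rewrite W_Z hZ; case/and3P: hA'.
    have uW' : (u + d).+1 \notin W by rewrite -addSn W_Z hZ; case/and3P: hA'.
    split=> //; first exact: sorted_mv.
    move=> t; rewrite (mem_mv t uW) hW.
    case: ltnP => /= td.
      have tu : t != u + d by rewrite neq_ltn (leq_trans td (leq_addl _ _)).
      by rewrite tu orbT.
    rewrite -(subnK td) !addnK eqn_add2r -addSn eqn_add2r (mem_mv _ uX).
    case: (eqVneq (t - d) u) => [->|tu] /=; last by rewrite orbA.
    (* Once [u] has left [X1], it could only remain through [X2] minus [Y], which [match_common]
       excludes. *)
    apply/esym/negbTE/negP => /andP[uX' uY].
    by move/negP: uY; apply; apply: match_common mY _ _.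
Qed.

Lemma is_match_id (X1 X2 : seq nat) :
  uniq X1 -> {subset X1 <= X2} -> uniq X2 -> exists Y, is_match X1 X2 Y /\ Y =i X1.
Proof.
move=> u1 s12 u2; have hm := phi_values_match u2 (uniq_leq_size u1 s12).
exists (phi_values X1 X2); split=> //; have [uY _ eY _] := hm.
have s1 : {subset X1 <= phi_values X1 X2}.
  by move=> t t1; apply: (match_common u1 hm t1); apply: s12.
move=> t; apply/esym.
by apply: (uniq_min_size u1 s1 _).2; rewrite eY.
Qed.

(** Every element is matched with itself, so the map only shifts the second set and fills the
    interval below [d]: on partitions it is the identity. *)
Lemma Psi_subset (d : nat) (X1 X2 Z : seq nat) :
  sorted ltn X1 -> sorted ltn X2 -> sorted ltn Z -> {subset X1 <= X2} ->
  (forall t, (t \in Z) = (t < d) || (t - d \in X2)) ->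
  Psi d (X1, X2) = (X1, Z).
Proof.
move=> s1 s2 sZ s12 hZ; have u1 := uniq_ltn s1; have u2 := uniq_ltn s2.
have sX := uniq_leq_size u1 s12.
have [Y [hm eY]] := is_match_id u1 s12 u2.
apply: is_Psi_eq => //; split=> //.
  apply: (match_perm _ hm); apply: uniq_perm => //. by case: hm.
move=> t; rewrite hZ -orbA; congr orb.
by have := s12 (t - d); case: (t - d \in X1) => [-> //|_]; rewrite andbT.
Qed.

(** * Cancellations in words *)

Fixpoint psum (a : nat -> int) (p : nat) : int :=
  if p is p'.+1 then (psum a p' + a p')%R else 0%R.

Definition is_letters (a : nat -> int) : Prop :=
  forall t, [|| a t == 1, a t == 0 | a t == -1]%R.

(* The letter 1 at p is the rightmost one surviving the cancellations iff p + 1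
   is the first index where the partial sums reach their maximum. *)
Definition good (a : nat -> int) (p : nat) : Prop :=
  [/\ a p = 1%R, forall q, q <= p -> (psum a q <= psum a p)%R
    & forall q, p < q -> (psum a q <= psum a p.+1)%R].

(** [cons_cancel] over arbitrary letters, so that the same cancellation runs on nodes and on their
    positions. *)
Definition ccons (T : Type) (isA isR : pred T) (g : T) (w : seq T) : seq T :=
  if w is g' :: w' then if isR g && isA g' then w' else g :: w else [:: g].

Lemma map_foldr_ccons (T U : eqType) (f : T -> U) (isA isR : pred T)
    (isA' isR' : pred U) (w : seq T) :
  (forall g, g \in w -> isA' (f g) = isA g /\ isR' (f g) = isR g) ->
  map f (foldr (ccons isA isR) [::] w)
    = foldr (ccons isA' isR') [::] (map f w)
  /\ {subset foldr (ccons isA isR) [::] w <= w}.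
Proof.
elim: w => [//|g w IH] hw /=.
have [|<- sub] := IH; first by move=> x xw; apply: hw; rewrite inE xw orbT.
have [_ eR] := hw g (mem_head _ _).
case: (foldr _ _ w) sub => [|g' r] sub /=.
  by split=> // x; rewrite !inE => ->.
have g'w : g' \in g :: w by rewrite inE (sub _ (mem_head _ _)) orbT.
have [eA _] := hw g' g'w; rewrite eA eR; case: ifP => _; split=> // x.
  by move=> xr; rewrite inE sub ?orbT // inE xr orbT.
by rewrite inE => /predU1P[->|/sub xw]; rewrite inE ?eqxx // xw orbT.
Qed.

Section Letters.

Variable a : nat -> int.
Hypothesis la : is_letters a.

Let isA p := a p == 1%R.
Let isR p := a p == (-1)%R.

Definition red (p k : nat) (r : seq nat) : seq nat :=
  foldr (ccons isA isR) r [seq t <- iota p k | a t != 0%R].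

Lemma redS (p k : nat) (r : seq nat) :
  red p k.+1 r =
  if a p != 0%R then ccons isA isR p (red p.+1 k r) else red p.+1 k r.
Proof. by rewrite /red /=; case: ifP. Qed.

Lemma red_cat (p k l : nat) (r : seq nat) :
  red p (k + l) r = red p k (red (p + k) l r).
Proof. by rewrite /red iotaD filter_cat foldr_cat. Qed.

Let AR r := r = filter isA r ++ filter (predC isA) r.

Lemma AR_head x r : AR (x :: r) -> ~~ isA x -> filter isA r = [::].
Proof.
rewrite /AR /= => h nA; move: h; rewrite (negbTE nA).
case: (filter isA r) (filter_all isA r) => [//|y s] /= /andP[Ay _] [xy _].
by rewrite xy Ay in nA.
Qed.

(** Induction from the left: a letter -1 at [p] raises by one the bound available for the rest of
    the word, then cancels the extra letter 1. The shape [AR] ensures that a surviving 1, if there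
    is any, is at the head and thus exposed to this cancellation. *)
Lemma red_max (p k h : nat) :
  (forall j, j <= k -> (psum a (p + j) <= psum a p + h%:Z)%R) ->
  AR (red p k [::]) /\ size (filter isA (red p k [::])) <= h.
Proof.
elim: k p h => [//|k IH] p h hj; rewrite redS.
have hj' j : j <= k -> (psum a (p.+1 + j) <= psum a p.+1 + h%:Z - a p)%R.
  by move=> jk; have := hj j.+1; rewrite addSnnS /= => /(_ jk); clear; lia.
have := la p; case/or3P=> /eqP ep; rewrite ep /=.
- have h0 : 0 < h by have := hj 1 isT; rewrite addn1 /= ep; clear; lia.
  have [|sh sz] := IH p.+1 h.-1.
    by move=> j /hj'; rewrite ep; move: h0; clear; lia.
  have Rp : isR p = false by rewrite /isR ep.
  have Ap : isA p by rewrite /isA ep.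
  have -> : ccons isA isR p (red p.+1 k [::]) = p :: red p.+1 k [::].
    by case: (red _ _ _) => [//|y r] /=; rewrite Rp.
  by rewrite /AR /= Ap /= -sh; split=> //; move: sz h0; clear; lia.
- by apply: IH => j /hj'; rewrite ep subr0.
have [|sh sz] := IH p.+1 h.+1.
  by move=> j /hj'; rewrite ep; clear; lia.
have Rp : isR p by rewrite /isR ep.
have Ap : isA p = false by rewrite /isA ep.
case: (red _ _ _) sh sz => [|y r] /= sh sz; first by rewrite /AR /= Ap.
rewrite Rp; case Ay : (isA y) => /=.
  by move: sh sz; rewrite /AR /= Ay /= => -[<-].
have nil := AR_head sh (negbT Ay).
by move: sh; rewrite /AR /= Ap Ay /= nil /= => -[<-].
Qed.

(** A letter 1 where the partial sums are maximal so far is never cancelled from the left: the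
    length of [As], known from the partial sums, is positive whenever a -1 looks for a partner, so
    that -1 takes a letter of [As]. *)
Lemma red_pre (p k : nat) (r : seq nat) : a (p + k) = 1%R ->
  (forall j, j <= k -> (psum a (p + j) <= psum a (p + k))%R) ->
  exists2 As, all isA As & red p k (p + k :: r) = As ++ p + k :: r
    /\ ((size As)%:Z = psum a (p + k) - psum a p)%R.
Proof.
move=> apk; elim: k p apk => [|k IH] p apk hj.
  by exists [::]; rewrite // addn0 subrr.
have [||As hA [eA sA]] := IH p.+1; first by rewrite addSnnS.
  by move=> j jk; rewrite !addSnnS; apply: hj.
rewrite redS -addSnnS eA.
have := la p; case/or3P=> /eqP ep; rewrite ep /=.
- exists (p :: As); first by rewrite /= hA /isA ep.
  split; last by rewrite /= -add1n PoszD sA /= ep; clear; lia.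
  have Rp : isR p = false by rewrite /isR ep.
  by case: (As) => [|y s] /=; rewrite Rp.
- by exists As => //; rewrite sA /= ep addr0.
have Rp : isR p by rewrite /isR ep.
have sA0 : 0 < size As.
  have := hj 0 isT; rewrite addn0 -addSnnS => h0.
  by move: h0 sA; rewrite /= ep; clear; lia.
case: As hA eA sA sA0 => [//|y s] /= /andP[Ay As] _ sA _.
by exists s => //; rewrite Rp Ay; split=> //; move: sA; rewrite ep; clear; lia.
Qed.

(** The word is cut at [p]: behind it no letter 1 survives, by [red_max] with bound 0, and before it
    only letters 1 remain, by [red_pre]. *)
Lemma good_red (N p : nat) : good a p -> p < N ->
  ohead (rev (filter isA (red 0 N [::]))) = Some p.
Proof.
move=> [ap h1 h2] pN.
have -> : N = p + (N - p.+1).+1 by move: pN; clear; lia.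
rewrite red_cat add0n redS ap /=.
have [|sh sz] := @red_max p.+1 (N - p.+1) 0.
  by move=> j _; rewrite addr0; apply: h2; rewrite addSn ltnS leq_addr.
have nil : filter isA (red p.+1 (N - p.+1) [::]) = [::] by apply/nilP;
  rewrite /nilp -leqn0.
have -> : ccons isA isR p (red p.+1 (N - p.+1) [::]) = p :: red p.+1 (N - p.+1) [::].
  by case: (red _ _ _) => [//|y r] /=; rewrite /isR ap.
have [||As hA] := @red_pre 0 p (red p.+1 (N - p.+1) [::]); rewrite ?add0n //.
case=> -> _; rewrite filter_cat /= {2}/isA ap /= nil.
by rewrite rev_cat.
Qed.

Lemma bad_red (N : nat) : (forall q, psum a q <= 0)%R ->
  filter isA (red 0 N [::]) = [::].
Proof.
move=> h; have [|_ sz] := @red_max 0 N 0; first by move=> j _; apply: h.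
by apply/nilP; rewrite /nilp -leqn0.
Qed.

Lemma first_argmax (S : nat -> int) (N : nat) : exists2 m, m <= N &
  (forall q, q <= N -> (S q <= S m)%R) /\ (forall q, q < m -> (S q < S m)%R).
Proof.
elim: N => [|N [m mN [h1 h2]]].
  by exists 0 => //; split=> // q; rewrite leqn0 => /eqP->.
case: (ltrP (S m) (S N.+1)) => h.
  exists N.+1 => //; split=> q.
    by rewrite leq_eqVlt => /predU1P[->//|]; rewrite ltnS => /h1 /le_lt_trans/(_ h)/ltW.
  by rewrite ltnS => /h1 /le_lt_trans/(_ h).
exists m; first exact: leqW.
by split=> // q; rewrite leq_eqVlt => /predU1P[->//|]; apply: h1.
Qed.

Lemma psum_const (N : nat) : (forall t, N <= t -> a t = 0%R) ->
  forall q, N <= q -> psum a q = psum a N.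
Proof.
move=> h q Nq; rewrite -(subnKC Nq); elim: (q - N) => [|k IH]; first by rewrite addn0.
by rewrite addnS /= IH h ?leq_addr // addr0.
Qed.

(** The first index at which the partial sums are maximal is either 0 or the successor of a good
    index. *)
Lemma good_or_bad (N : nat) : (forall t, N <= t -> a t = 0%R) ->
  (exists2 p, p < N & good a p) \/ (forall q, psum a q <= 0)%R.
Proof.
move=> h; have cst := psum_const h.
have [m mN [h1 h2]] := first_argmax (psum a) N.
have h1' q : (psum a q <= psum a m)%R.
  by case: (leqP q N) => [|/ltnW Nq]; [exact: h1 | rewrite cst ?h1].
case: m mN h1 h2 h1' => [|p] mN h1 h2 h1'; [by right | left].
exists p => //; have h3 := h2 p (ltnSn _).
have ap : a p = 1%R by move: h3 => /=; move: (la p) => /or3P[]/eqP->; clear; lia.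
split=> // q.
by rewrite -ltnS => /h2; rewrite /= ap; clear; lia.
Qed.

End Letters.

(** * Beta sets and Kashiwara operators *)

Lemma sorted_geqP (l : seq nat) :
  reflect (forall a, nth 0 l a.+1 <= nth 0 l a) (sorted geq l).
Proof.
apply: (iffP (sortedP 0)) => [h a|h a _]; last exact: h.
by case: (ltnP a.+1 (size l)) => [/h//|sa]; rewrite nth_default.
Qed.

Lemma nth_geq (l : seq nat) (a b : nat) :
  sorted geq l -> a <= b -> nth 0 l b <= nth 0 l a.
Proof.
move=> /sorted_geqP h /subnKC<-; elim: (b - a) => [|k IH]; first by rewrite addn0.
by rewrite addnS; apply: leq_trans IH.
Qed.

Lemma nth_decr_nth (l : seq nat) (a b : nat) :
  nth 0 (decr_nth l a) b = nth 0 l b - (a == b).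
Proof.
rewrite /decr_nth nth_set_nth /= eq_sym.
by case: eqP => [->|_]; rewrite ?subn0 ?subn1.
Qed.

(* Ascending list of the numbers [la_a + m - a], [1 <= a <= m]. *)
Definition beta (m : nat) (l : seq nat) : seq nat :=
  [seq nth 0 l (m - k.+1) + k | k <- iota 0 m].

Lemma size_beta m l : size (beta m l) = m.
Proof. by rewrite size_map size_iota. Qed.

Lemma betaP (m : nat) (l : seq nat) (v : nat) :
  reflect (exists2 a, a < m & v = nth 0 l a + (m - a.+1)) (v \in beta m l).
Proof.
apply: (iffP mapP) => [[k]|[a am ->]].
  rewrite mem_iota /= add0n => km ->; exists (m - k.+1); first by lia.
  by congr addn; lia.
exists (m - a.+1); first by rewrite mem_iota; lia.
by congr (nth _ _ _ + _); lia.
Qed.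

Lemma sorted_beta (m : nat) (l : seq nat) : sorted geq l -> sorted ltn (beta m l).
Proof.
move=> sl; rewrite sorted_map.
apply: (@sub_in_sorted _ (mem (iota 0 m)) ltn) => //; last exact: iota_ltn_sorted.
move=> x y; rewrite !mem_iota /= => xm ym xy.
by have := @nth_geq l (m - y.+1) (m - x.+1) sl; lia.
Qed.

Lemma addable_size (l : seq nat) (a : nat) :
  sorted geq (incr_nth l a) -> a <= size l.
Proof.
move=> /sorted_geqP h; rewrite leqNgt; apply/negP => al.
case: a al h => [//|a] al /(_ a).
by rewrite !nth_incr_nth eqxx gtn_eqF // !nth_default //; lia.
Qed.

Lemma mem0_beta (m : nat) (l : seq nat) : size l < m -> 0 \in beta m l.
Proof.
move=> lm; apply/betaP; exists m.-1; first by lia.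
by rewrite nth_default; lia.
Qed.

Section Letter.

Variables (m : nat) (l : seq nat).
Hypothesis sl : sorted geq l.
Hypothesis lm : size l < m.

(** With rows counted from 0, adding a node in row [a] raises the beta number
    [nth 0 l a + (m - a.+1)], so its letter sits one step higher. As [size l < m], the first empty
    row has a beta number too, and the node addable there is not lost. *)
Lemma letter_add a : sorted geq (incr_nth l a) ->
  letter (beta m l) (nth 0 l a + (m - a)) = 1%R.
Proof.
move=> h; have al := addable_size h.
have -> : letter (beta m l) (nth 0 l a + (m - a)) = (true%:Z - false%:Z)%R; last by [].
congr (Posz (nat_of_bool _) - Posz (nat_of_bool _))%R.
  by apply/betaP; exists a; lia.
apply/negbTE/negP => /betaP[b bm e].
case: (ltnP b a) => ab; last by have := nth_geq sl ab; lia.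
have := @nth_geq _ b a h; rewrite !nth_incr_nth eqxx (ltnW ab) => /(_ isT).
by rewrite gtn_eqF //; lia.
Qed.

Lemma letter_addP v : letter (beta m l) v = 1%R ->
  exists2 a, sorted geq (incr_nth l a) & v = nth 0 l a + (m - a).
Proof.
rewrite /letter; case: betaP => [[a am e]|//]; case: betaP => // h _.
have v0 : 0 < v.
  by case: v e h => // e; case; exists a.
exists a; last by lia.
apply/sorted_geqP => b; rewrite !nth_incr_nth.
have hs := elimT (sorted_geqP l) sl b.
case: (eqVneq a b.+1) => [ab|_]; last by lia.
move: e am; rewrite ab => e am.
case: (ltnP (nth 0 l b.+1) (nth 0 l b)) => hb; first by lia.
by case: h; exists b; lia.
Qed.

Lemma letter_rem a : 0 < nth 0 l a -> sorted geq (decr_nth l a) ->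
  letter (beta m l) (nth 0 l a + (m - a.+1)) = (-1)%R.
Proof.
move=> l0 h; have al : a < size l.
  by rewrite ltnNge; apply/negP => al; rewrite nth_default in l0.
have -> : letter (beta m l) (nth 0 l a + (m - a.+1)) = (false%:Z - true%:Z)%R;
  last by [].
congr (Posz (nat_of_bool _) - Posz (nat_of_bool _))%R; last first.
  by apply/betaP; exists a; lia.
apply/negbTE/negP => /betaP[b bm e].
case: (leqP b a) => ab; first by have := nth_geq sl ab; lia.
have := nth_geq h (ltnW ab); rewrite !nth_decr_nth eqxx ltn_eqF //; lia.
Qed.

Lemma letter_remP v : letter (beta m l) v = (-1)%R ->
  exists a, [/\ 0 < nth 0 l a, sorted geq (decr_nth l a)
              & v = nth 0 l a + (m - a.+1)].
Proof.
rewrite /letter; case: betaP => [//|h]; case: betaP => // -[a am e] _.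
have hS : nth 0 l a.+1 < nth 0 l a.
  rewrite ltnNge; apply/negP => hb; apply: h.
  case: (ltnP a.+1 m) => am'; first by exists a.+1 => //;
    have := nth_geq sl (leqnSn a); lia.
  by exists a => //; move: e; rewrite (nth_default _ (_ : size l <= a)); lia.
exists a; split=> //; first by lia.
apply/sorted_geqP => b; rewrite !nth_decr_nth.
have := elimT (sorted_geqP l) sl b.
by case: (eqVneq a b) => [<-|_]; lia.
Qed.

Lemma row_inj a b : a <= m -> b <= m ->
  nth 0 l a + (m - a) = nth 0 l b + (m - b) -> a = b.
Proof.
move=> am bm e; case: (ltngtP a b) => // ab.
  by have := nth_geq sl (ltnW ab); lia.
by have := nth_geq sl (ltnW ab); lia.
Qed.

Lemma beta_incr a : sorted geq (incr_nth l a) ->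
  beta m (incr_nth l a) = mv (nth 0 l a + (m - a)).-1 (beta m l).
Proof.
move=> h; have al := addable_size h.
rewrite /mv -map_comp; apply/eq_in_map => k; rewrite mem_iota /= add0n => km.
rewrite nth_incr_nth; case: (eqVneq a (m - k.+1)) => [->|ne].
  by rewrite ifT; [lia | apply/eqP; lia].
rewrite ifF //; apply/eqP => e; case/eqP: ne.
by apply: row_inj; lia.
Qed.

End Letter.

Lemma part_ext (l l' : seq nat) : is_part l -> is_part l' ->
  (forall a, nth 0 l a = nth 0 l' a) -> l = l'.
Proof.
move=> pl pl' h; apply: (@eq_from_nth _ 0); last by move=> i _; apply: h.
wlog s : l l' pl pl' h / size l < size l'.
  move=> H; case: (ltngtP (size l) (size l')) => // s; first exact: H.
  by apply/esym; apply: H.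
case/andP: pl' => _ /negP[]; have := h (size l).
by rewrite nth_default // => ->; apply: mem_nth.
Qed.

Lemma beta_inj (m : nat) (l l' : seq nat) : is_part l -> is_part l' ->
  size l <= m -> size l' <= m -> beta m l = beta m l' -> l = l'.
Proof.
move=> pl pl' lm lm' e; apply: part_ext => // a.
case: (ltnP a m) => am; last by rewrite !nth_default //; lia.
have := congr1 (fun s => nth 0 s (m - a.+1)) e.
rewrite !(nth_map 0) ?size_iota ?nth_iota ?add0n; try by lia.
by move=> /addIn; rewrite (_ : m - (m - a.+1).+1 = a) //; lia.
Qed.

Lemma incr_part (l : seq nat) (a : nat) :
  is_part l -> sorted geq (incr_nth l a) -> is_part (incr_nth l a).
Proof.
move=> /andP[sl l0] h; rewrite /is_part h /=; apply/negP => /(nthP 0)[b].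
rewrite size_incr_nth nth_incr_nth => bs.
case: (eqVneq a b) => [//|ab]; rewrite add0n => e.
have al := addable_size h.
case: (ltnP b (size l)) => bl; first by case/negP: l0; rewrite -e mem_nth.
by move: bs; case: ifP => al'; lia.
Qed.

(** * Words of nodes as words of letters *)

Definition msize (M s c : nat) : nat := if c == 1 then M else M + s.

Definition bset (M s : nat) (la : bipart) (c : nat) : seq nat :=
  beta (msize M s c) (component la c).

(* At the positions 2 k and 2 k + 1 of the word for the residue i one finds the
   letters of components 2 and 1 for the k-th content that is congruent to i. *)
Definition offset (d M : nat) (i : int) : nat := `|((i + M%:Z) %% d%:Z)%Z|%N.

Definition poscomp (p : nat) : nat := if odd p then 1 else 2.

Definition wletter (d M s : nat) (i : int) (la : bipart) (p : nat) : int :=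
  letter (bset M s la (poscomp p)) (offset d M i + p./2 * d).

Lemma is_letters_word (d M s : nat) (i : int) (la : bipart) :
  is_letters (wletter d M s i la).
Proof. by move=> t; apply: letter_values. Qed.

Definition bounded (M s : nat) (la : bipart) : Prop :=
  [/\ sorted geq la.1, sorted geq la.2, size la.1 < M & size la.2 < M + s].

Lemma offset_lt (d M : nat) (i : int) : 0 < d -> offset d M i < d.
Proof.
move=> d0; rewrite /offset.
have := @ltz_pmod (i + M%:Z)%R d%:Z%R; have := @modz_ge0 (i + M%:Z)%R d%:Z%R.
by lia.
Qed.

Section Word.

Variables (d M s : nat) (i : int) (la : bipart).
Hypothesis d0 : 0 < d.
Hypothesis bla : bounded M s la.

Let ch : int * int := (0%R, s%:Z%R).

Let sorted_component c : sorted geq (component la c).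
Proof. by case: bla => ? ? _ _; rewrite /component; case: ifP. Qed.

Let size_component c : size (component la c) < msize M s c.
Proof. by case: bla => _ _ ? ?; rewrite /component /msize; case: ifP. Qed.

Let value (g : node) : nat := `|(content ch g + M%:Z)%R|%N.

Let valueE a b c : a <= msize M s c -> c \in [:: 1; 2] ->
  (content ch (a, b, c) + M%:Z = b%:Z + (msize M s c - a)%:Z)%R.
Proof.
rewrite /content /charge /msize /ch /= !inE.
by move=> h /orP[]/eqP e; rewrite e /= in h *; lia.
Qed.

Let addable_spec g : addable la g ->
  [/\ (content ch g + M%:Z = (value g)%:Z)%R, letter (bset M s la g.2) (value g) = 1%R,
      g.2 \in [:: 1; 2] & g \in addable_nodes la].
Proof.
move=> h; rewrite mem_filter h andTb.
case: g h => [[a b] c] /and4P[a0 c12 /eqP eb hs].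
have al := addable_size hs; have lm := size_component c.
have e : (content ch (a, b, c) + M%:Z = (nth 0 (component la c) a.-1 + (msize M s c -
  a.-1))%N%:Z)%R.
  rewrite valueE //; last by lia.
  rewrite eb /Defs.row. lia.
rewrite /value e absz_nat; split=> //; first exact: letter_add.
apply/allpairsPdep; exists c, a; split=> //; last by rewrite -eb.
by rewrite mem_iota; lia.
Qed.

Let removable_spec g : removable la g ->
  [/\ (content ch g + M%:Z = (value g)%:Z)%R, letter (bset M s la g.2) (value g) =
    (-1)%R,
      g.2 \in [:: 1; 2] & g \in removable_nodes la].
Proof.
move=> h; rewrite mem_filter h andTb.
case: g h => [[a b] c] /and5P[a0 c12 b0 /eqP eb hs].
have lm := size_component c.
have al : a.-1 < size (component la c).
  by rewrite ltnNge; apply/negP => h; rewrite eb /Defs.row nth_default in b0.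
have e : (content ch (a, b, c) + M%:Z = (nth 0 (component la c) a.-1 + (msize M s c -
  a.-1.+1))%N%:Z)%R.
  rewrite valueE //; last by lia.
  rewrite eb /Defs.row. lia.
rewrite /value e absz_nat; split=> //.
  by apply: letter_rem => //; rewrite -/(Defs.row la a c) -eb.
apply/allpairsPdep; exists c, a; split=> //; last by rewrite -eb.
by rewrite mem_iota; lia.
Qed.

Let addable_ex c v : c \in [:: 1; 2] -> letter (bset M s la c) v = 1%R ->
  exists g, [/\ addable la g, g.2 = c & value g = v].
Proof.
move=> c12 /(letter_addP (sorted_component c) (size_component c))[a hs ->].
have al := addable_size hs; have lm := size_component c.
exists (a.+1, (Defs.row la a.+1 c).+1, c); split=> //;
  first by rewrite /addable c12 eqxx hs.
by rewrite /value valueE // /Defs.row /=; lia.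
Qed.

Let removable_ex c v : c \in [:: 1; 2] -> letter (bset M s la c) v = (-1)%R ->
  exists g, [/\ removable la g, g.2 = c & value g = v].
Proof.
move=> c12 /(letter_remP (sorted_component c) (size_component c))[a [b0 hs ->]].
have lm := size_component c.
have al : a < size (component la c).
  by rewrite ltnNge; apply/negP => h; rewrite nth_default in b0.
exists (a.+1, Defs.row la a.+1 c, c); split=> //.
  by apply/and5P; split.
by rewrite /value valueE // /Defs.row /=; lia.
Qed.

Let is_node g := addable la g || removable la g.

Let addable_inj g g' : addable la g -> addable la g' -> g.2 = g'.2 ->
  value g = value g' -> g = g'.
Proof.
case: g => [[a b] c]; case: g' => [[a' b'] c'] /= h h' ec; rewrite -{}ec in h' *.
case/and4P: h => a0 c12 /eqP eb hs; case/and4P: h' => a0' _ /eqP eb' hs'.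
have lm := size_component c; have sl := sorted_component c.
have al := addable_size hs; have al' := addable_size hs'.
rewrite /value !valueE //; try by lia.
move=> ev; have e : a.-1 = a'.-1.
  apply: (row_inj sl (m := msize M s c)); try by lia.
  by move: ev; rewrite eb eb' /Defs.row; lia.
have {}e : a = a' by lia.
by rewrite eb eb' e.
Qed.

Let removable_inj g g' : removable la g -> removable la g' -> g.2 = g'.2 ->
  value g = value g' -> g = g'.
Proof.
case: g => [[a b] c]; case: g' => [[a' b'] c'] /= h h' ec; rewrite -{}ec in h' *.
case/and5P: h => a0 c12 b0 /eqP eb _; case/and5P: h' => a0' _ b0' /eqP eb' _.
have lm := size_component c; have sl := sorted_component c.
have al : a.-1 < size (component la c).
  by rewrite ltnNge; apply/negP => h; rewrite eb /Defs.row nth_default in b0.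
have al' : a'.-1 < size (component la c).
  by rewrite ltnNge; apply/negP => h; rewrite eb' /Defs.row nth_default in b0'.
rewrite /value !valueE //; try by lia.
move=> ev; have e : a.-1 = a'.-1.
  apply: (row_inj sl (m := msize M s c)); try by lia.
  by move: ev; rewrite eb eb' /Defs.row; lia.
have {}e : a = a' by lia.
by rewrite eb eb' e.
Qed.

Let node_letter g : is_node g ->
  addable la g = (letter (bset M s la g.2) (value g) == 1%R)
  /\ removable la g = (letter (bset M s la g.2) (value g) == (-1)%R).
Proof.
rewrite /is_node; case A: (addable la g) => /=.
  have [_ l1 _ _] := addable_spec A; rewrite l1 => _; split=> //.
  by apply/negbTE/negP => /removable_spec[_ + _ _]; rewrite l1.
by move=> R; have [_ l1 _ _] := removable_spec R; rewrite R l1.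
Qed.

Let node_inj g g' : is_node g -> is_node g' -> g.2 = g'.2 -> value g = value g' ->
  g = g'.
Proof.
move=> h h' ec ev; have [eA eR] := node_letter h; have [eA' eR'] := node_letter h'.
rewrite ec ev -eA' in eA; rewrite ec ev -eR' in eR.
case/orP: (h) => x; first by apply: addable_inj; rewrite // -eA.
by apply: removable_inj; rewrite // -eR.
Qed.

(** The numbering of [wletter]: quotient of the shifted content by [d] first, then component 2
    before component 1. Inside a residue class this is the order [prec]. *)
Let posn (g : node) : nat := (value g %/ d).*2 + (g.2 == 1).

Let is_inodeE g : (content ch g + M%:Z = (value g)%:Z)%R ->
  is_inode d ch i g = (value g %% d == offset d M i).
Proof.
move=> e; rewrite /is_inode /offset -(eqz_modDr M%:Z) e modz_nat.
by rewrite -[X in _ == X]gez0_abs ?modz_ge0 //; lia.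
Qed.

Let mem_word g : (g \in inode_word d ch i la) = is_node g && (value g %% d == offset
  d M i).
Proof.
rewrite mem_sort mem_filter mem_cat.
have eA : (g \in addable_nodes la) = addable la g.
  by apply/idP/idP => [|/addable_spec[]//]; rewrite mem_filter => /andP[].
have eR : (g \in removable_nodes la) = removable la g.
  by apply/idP/idP => [|/removable_spec[]//]; rewrite mem_filter => /andP[].
rewrite eA eR andbC; case N: (addable la g || removable la g); rewrite /is_node N //=.
by apply: is_inodeE; case/orP: N => [/addable_spec|/removable_spec][].
Qed.

Let mem_word_comp g : g \in inode_word d ch i la -> g.2 \in [:: 1; 2].
Proof.
rewrite mem_word => /andP[+ _].
by case/orP=> [/addable_spec|/removable_spec][].
Qed.

Let posn_word g : g \in inode_word d ch i la ->
  wletter d M s i la (posn g) = letter (bset M s la g.2) (value g).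
Proof.
move=> gw; have := mem_word_comp gw; move: gw; rewrite mem_word => /andP[_ /eqP e].
rewrite /wletter /posn /poscomp oddD odd_double /= => c12.
have -> : ((value g %/ d).*2 + (g.2 == 1))./2 = value g %/ d by case: (g.2 == 1); lia.
rewrite -e [_ %% _ + _]addnC -divn_eq.
by move: c12; rewrite !inE => /orP[]/eqP->.
Qed.

Let uniq_word : uniq (inode_word d ch i la).
Proof.
rewrite sort_uniq filter_uniq // cat_uniq.
have uA : uniq (addable_nodes la).
  rewrite filter_uniq //; apply: allpairs_uniq_dep; [by [] | by move=> c _;
    exact: iota_uniq | ].
  by move=> [c a] [c' a'] _ _ /= [-> _ ->].
have uR : uniq (removable_nodes la).
  rewrite filter_uniq //; apply: allpairs_uniq_dep; [by [] | by move=> c _;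
    exact: iota_uniq | ].
  by move=> [c a] [c' a'] _ _ /= [-> _ ->].
rewrite uA uR andbT; apply/hasPn => g; rewrite !mem_filter => /andP[R _].
by apply/negP => /andP[/addable_spec[_ + _ _] _]; case/removable_spec: R => _ ->.
Qed.

Let sorted_posn : sorted ltn (map posn (inode_word d ch i la)).
Proof.
rewrite ltn_sorted_uniq_leq; apply/andP; split.
  rewrite map_inj_in_uniq ?uniq_word // => g g' gw gw' e.
  have := mem_word_comp gw; have := mem_word_comp gw'.
  move: gw gw'; rewrite !mem_word => /andP[n /eqP v] /andP[n' /eqP v'] c12 c12'.
  have /andP[/eqP e2 /eqP ev] : (g.2 == g'.2) && (value g %/ d == value g' %/ d).
    move: e c12 c12'; rewrite /posn !inE => e /orP[]/eqP c /orP[]/eqP c';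
      rewrite c c' /= in e *; lia.
  by apply: node_inj => //; rewrite (divn_eq (value g) d) v ev -v' -divn_eq.
rewrite sorted_map; apply: (@sub_in_sorted _ (mem (inode_word d ch i la)) (fun g g'
  => ~~ prec ch g' g)); rewrite ?allss //; last first.
  by apply: sort_sorted => g g'; rewrite /prec; lia.
move=> g g' gw gw' /=.
  have := mem_word_comp gw; have := mem_word_comp gw'.
  move: gw gw'; rewrite !mem_word => /andP[n /eqP v] /andP[n' /eqP v'] c12 c12'.
have ev : (content ch g + M%:Z = (value g)%:Z)%R by case/orP: n
  => [/addable_spec|/removable_spec][].
have ev' : (content ch g' + M%:Z = (value g')%:Z)%R by case/orP: n'
  => [/addable_spec|/removable_spec][].
rewrite /prec /posn => h.
have {h} : (value g < value g') || (value g == value g') && (g'.2 <= g.2).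
  move: h; rewrite negb_or negb_and -leNgt -leqNgt -(lerD2r M%:Z%R) -(inj_eq (addIr
    M%:Z%R)) ev ev'.
  by rewrite lez_nat eqz_nat leq_eqVlt (eq_sym (value g')); case: ltngtP.
case/orP => [vv|/andP[/eqP-> cc]].
  have qq : value g %/ d < value g' %/ d.
    rewrite ltnNge; apply/negP => qq; move: vv.
    by rewrite (divn_eq (value g) d) (divn_eq (value g') d) v v' ltn_add2r ltnNge
      leq_mul2r qq orbT.
  by move: qq; clear; case: (g.2 == 1); case: (g'.2 == 1); lia.
by move: cc c12 c12'; rewrite leq_add2l !inE => cc /orP[]/eqP c /orP[]/eqP c';
  rewrite c c' in cc *.
Qed.

(** Both lists are strictly increasing, so it is enough that they have the same elements: every
    nonzero letter comes from an addable or removable node. *)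
Let map_posn N : (forall t, N <= t -> wletter d M s i la t = 0%R) ->
  map posn (inode_word d ch i la) = [seq t <- iota 0 N | wletter d M s i la t != 0%R].
Proof.
move=> hN; apply: sorted_ltn_eq => //.
  by apply: sorted_filter; [exact: ltn_trans | exact: iota_ltn_sorted].
move=> t; rewrite mem_filter mem_iota /= add0n.
apply/mapP/andP => [[g gw ->]|[at0 tN]].
  have nz : wletter d M s i la (posn g) != 0%R.
    rewrite posn_word //; move: gw; rewrite mem_word => /andP[+ _].
    by case/orP=> [/addable_spec|/removable_spec] [_ -> _ _].
  split=> //; rewrite ltnNge; apply/negP => /hN e.
  by rewrite e eqxx in nz.
have c12 : poscomp t \in [:: 1; 2] by rewrite /poscomp; case: ifP.
have [g [n ec ev]] : exists g, [/\ is_node g, g.2 = poscomp t & value g = offset d M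
  i + t./2 * d].
  move: at0; case/or3P: (is_letters_word d M s i la t) => /eqP e; rewrite e // => _.
    by have [g [h ? ?]] := addable_ex c12 e; exists g; split=> //; rewrite /is_node h.
  by have [g [h ? ?]] := removable_ex c12 e; exists g; split=> //;
    rewrite /is_node h orbT.
have od : offset d M i < d by exact: offset_lt.
exists g; first by rewrite mem_word n ev addnC modnMDl modn_small ?eqxx.
rewrite /posn ev [offset _ _ _ + _]addnC divnMDl // divn_small
  // addn0 ec /poscomp -[LHS]odd_double_half.
by case: (odd t); rewrite addnC.
Qed.

Lemma wletter_eq0 : exists N, forall t, N <= t -> wletter d M s i la t = 0%R.
Proof.
have hb c : exists B, forall v, B <= v -> letter (bset M s la c) v = 0%R.
  exists (\max_(x <- bset M s la c) x).+2 => v hv.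
  have h u : u \in bset M s la c -> u <= \max_(x <- bset M s la c) x.
    by move=> ub; apply: leq_bigmax_seq.
  rewrite /letter; case v1: (_ \in _); first by have := h _ v1; lia.
  by case v2: (_ \in _); first by have := h _ v2; lia.
have [B1 h1] := hb 1; have [B2 h2] := hb 2.
exists (maxn B1 B2).*2.+1 => t ht; have tt : maxn B1 B2 <= t./2 * d.
  by rewrite (leq_trans _ (leq_pmulr _ d0)) //; lia.
by rewrite /wletter /poscomp; case: ifP => _; [apply: h1 | apply: h2]; lia.
Qed.

Let reduced_posn N : (forall t, N <= t -> wletter d M s i la t = 0%R) ->
  map posn [seq g <- reduced_word d ch i la | addable la g]
    = [seq t <- red (wletter d M s i la) 0 N [::] | wletter d M s i la t == 1%R]
  /\ {subset reduced_word d ch i la <= inode_word d ch i la}.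
Proof.
move=> hN; set a := wletter d M s i la.
have [|e sub] := @map_foldr_ccons _ _ posn (addable la) (removable la)
  (fun p => a p == 1%R) (fun p => a p == (-1)%R) (inode_word d ch i la).
  move=> g gw; have [eA eR] : addable la g = (a (posn g) == 1%R)
    /\ removable la g = (a (posn g) == (-1)%R).
    rewrite /a posn_word //; apply: node_letter.
    by move: gw; rewrite mem_word => /andP[].
  by rewrite eA eR.
split=> //; rewrite /red -(map_posn hN) -e filter_map; congr map.
apply: eq_in_filter => g /sub gw /=.
rewrite /a posn_word //; move: gw; rewrite mem_word => /andP[n _].
by case: (node_letter n).
Qed.

(** By [good_red] the rightmost surviving addable node has position [p], from which its component
    and its value are read off; [a] is its row, counted from 0. *)
Lemma ftilde_good p : good (wletter d M s i la) p ->
  exists a, [/\ ftilde d ch i la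
        = Some (set_component la (poscomp p) (incr_nth (component la (poscomp p)) a)),
      sorted geq (incr_nth (component la (poscomp p)) a)
    & offset d M i + p./2 * d
        = nth 0 (component la (poscomp p)) a + (msize M s (poscomp p) - a)].
Proof.
move=> gp; have [N0 hN0] := wletter_eq0.
set N := maxn N0 p.+1.
have hN t : N <= t -> wletter d M s i la t = 0%R.
  by move=> h; apply: hN0; apply: leq_trans h; apply: leq_maxl.
have [e sub] := reduced_posn hN.
have pN : p < N by rewrite leq_max leqnn orbT.
have := good_red (is_letters_word d M s i la) gp pN; rewrite -e -map_rev.
case er : (rev _) => [//|g r] /= [eg].
have : g \in rev [seq g <- reduced_word d ch i la | addable la g]
  by rewrite er mem_head.
rewrite mem_rev mem_filter => /andP[A /sub gw].
have ec : g.2 = poscomp p.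
  have := mem_word_comp gw; rewrite -eg /posn /poscomp oddD odd_double !inE /=.
  by case/orP=> /eqP->.
have ev : value g = offset d M i + p./2 * d.
  move: gw; rewrite mem_word => /andP[_ /eqP v].
  rewrite -v -eg /posn; have -> : ((value g %/ d).*2 + (g.2 == 1))./2 = value g %/ d
    by case: (g.2 == 1); lia.
  by rewrite addnC -divn_eq.
rewrite /ftilde /good_addable er /=.
case: g A {gw er} eg ec ev => [[b1 b2] c] /[dup] A /and4P[a0 c12 /eqP eb hs] eg /= ec
  ev.
rewrite -ec; exists b1.-1; split=> //.
have lm := size_component c; have al := addable_size hs.
by rewrite -ev /value valueE // ?eb /Defs.row; lia.
Qed.

Lemma ftilde_some la' : ftilde d ch i la = Some la' ->
  exists p, good (wletter d M s i la) p.
Proof.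
have [N hN] := wletter_eq0.
have [[p _ gp]|bad] := good_or_bad (is_letters_word d M s i la) hN; first by exists p.
have [e _] := reduced_posn hN.
move: e; rewrite (bad_red (is_letters_word d M s i la)) // /ftilde /good_addable.
by case: [seq g <- _ | _].
Qed.

End Word.

(** * Psi computes psi *)

(* b is a with its blocks of two letters delayed by one position and replaced
   by blocks with the same reduction. *)
Lemma good_shift (a b : nat -> int) (p : nat) :
  is_letters a -> is_letters b -> b 0 = 0%R ->
  (forall k, a k.*2 + a k.*2.+1 = b k.*2.+1 + b k.*2.+2)%R ->
  (forall k, height2 (a k.*2) (a k.*2.+1) = height2 (b k.*2.+1) (b k.*2.+2)) ->
  good a p ->
  let k := p./2 in
  [/\ (if odd p then act_snd (a k.*2) (a k.*2.+1) else act_fst (a k.*2) (a k.*2.+1)),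
      act_fst (b k.*2.+1) (b k.*2.+2) -> good b k.*2.+1
    & act_snd (b k.*2.+1) (b k.*2.+2) -> good b k.*2.+2].
Proof.
move=> la lb b0 e1 e2 [ap h1 h2] k.
have S k' : psum b k'.*2.+1 = psum a k'.*2.
  elim: k' => [|k' IH]; first by rewrite /= b0.
  by rewrite doubleS [LHS]/= -/(psum b k'.*2.+1) IH /= -addrA -e1 addrA.
set m := psum a p.+1.
have mE : m = (psum a p + 1)%R by rewrite /m /= ap.
have hlt q : q <= p -> (psum a q < m)%R by move/h1; rewrite mE; clear; lia.
have hle q : (psum a q <= m)%R.
  by case: (leqP q p) => [/hlt/ltW//|]; apply: h2.
have kp : k.*2 <= p by rewrite /k; clear; lia.
(* Odd indices are the block boundaries of [b], where its partial sums are those of [a]; an even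
   positive index is inside a block, where the equality of heights transfers the bound. *)
have blt q : q <= k.*2.+1 -> (psum b q < m)%R.
  case: (boolP (odd q)) => oq qk.
    have -> : q = q./2.*2.+1 by move: oq; clear; lia.
    by rewrite S; apply: hlt; move: qk kp oq; clear; lia.
  case: q oq qk => [_ _|q oq qk]; first exact: (hlt 0).
  have -> : q = q./2.*2.+1 by move: oq; clear; lia.
  have i0 : q./2.*2.+2 <= p by move: qk kp oq; clear; lia.
  move: (hlt _ i0) (hlt _ (ltnW i0)) (hlt _ (ltnW (ltnW i0))) (e2 q./2) (e1 q./2).
  by rewrite [psum b _]/= -/(psum b q./2.*2.+1) S /= /height2; clear; lia.
have ble q : (psum b q <= m)%R.
  case: (boolP (odd q)) => oq.
    have -> : q = q./2.*2.+1 by move: oq; clear; lia.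
    by rewrite S; apply: hle.
  case: q oq => [_|q oq]; first exact: (hle 0).
  have -> : q = q./2.*2.+1 by move: oq; clear; lia.
  move: (hle q./2.*2.+2) (hle q./2.*2.+1) (hle q./2.*2) (e2 q./2) (e1 q./2).
  by rewrite [psum b _]/= -/(psum b q./2.*2.+1) S /= /height2; clear; lia.
(* The maximum [m] of the partial sums of [a] is attained inside block [k]. *)
have hm : (m = psum a k.*2 + height2 (a k.*2) (a k.*2.+1))%R.
  move: (hle k.*2) (hle k.*2.+1) (hle k.*2.+2) => /= h3 h4 h5; move: h3 h4 h5.
  have [e|e] : p = k.*2 \/ p = k.*2.+1 by rewrite /k; clear; lia.
    by rewrite /m e /= /height2; clear; lia.
  by rewrite /m e /= /height2; clear; lia.
have Sb := S k; rewrite e2 in hm.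
split.
- case: (boolP (odd p)) => op.
    have e : p = k.*2.+1 by move: op; rewrite /k; clear; lia.
    have ak : a k.*2.+1 = 1%R by rewrite -e.
    have ep : psum a p = (psum a k.*2 + a k.*2)%R by rewrite e.
    rewrite /act_snd ak; move: (hlt _ kp) (la k.*2); rewrite mE ep.
    by clear; lia.
  have e : p = k.*2 by move: op; rewrite /k; clear; lia.
  have ak : a k.*2 = 1%R by rewrite -e.
  have ep : psum a k.*2.+2 = (psum a p + a k.*2 + a k.*2.+1)%R by rewrite [p]e.
  by rewrite /act_fst; move: (hle k.*2.+2); rewrite mE ep ak; clear; lia.
- rewrite /act_fst => /andP[/eqP b1 b2].
  have em : psum b k.*2.+2 = m.
    rewrite [LHS]/= -/(psum b k.*2.+1) Sb hm b1 /height2.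
    by move: b2 (lb k.*2.+2); clear; lia.
  split=> // q; last by rewrite em => _; apply: ble.
  by move/blt; rewrite -em [psum b k.*2.+2]/= b1 -/(psum b k.*2.+1); clear; lia.
rewrite /act_snd => /andP[/eqP b2 b1].
have em : psum b k.*2.+3 = m.
  rewrite [LHS]/= -/(psum b k.*2.+1) Sb hm b2 /height2.
  by move: b1 (lb k.*2.+1); clear; lia.
have em' : (psum b k.*2.+2 = m - 1)%R.
  by rewrite -em [psum b k.*2.+3]/= b2 -/(psum b k.*2.+2) addrK.
split=> // q; last by rewrite em => _; apply: ble.
rewrite leq_eqVlt ltnS => /predU1P[->//|/blt].
by rewrite em'; clear; lia.
Qed.

Definition bipart_ok (la : bipart) : bool := is_part la.1 && is_part la.2.

Definition betas (M s : nat) (la : bipart) : seq nat * seq nat :=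
  (beta M la.1, beta (M + s) la.2).

Lemma size_part (l : seq nat) : is_part l -> size l <= sumn l.
Proof.
case/andP=> _; elim: l => [//|x l IH]; rewrite inE negb_or /= => /andP[x0 /IH].
by lia.
Qed.

Lemma bounded_rank (M s : nat) (la : bipart) :
  bipart_ok la -> rank la < M -> bounded M s la.
Proof.
move=> /andP[p1 p2]; rewrite /rank => h.
have := size_part p1; have := size_part p2; case/andP: p1 => ? _; case/andP: p2 => ? _.
by move=> ? ?; split=> //; lia.
Qed.

Definition bmove (la : seq nat * seq nat) (p u : nat) : seq nat * seq nat :=
  if odd p then (mv u la.1, la.2) else (la.1, mv u la.2).

Lemma sumn_incr_nth (l : seq nat) (a : nat) : sumn (incr_nth l a) = (sumn l).+1.
Proof.
elim: l a => [|x l IH] [|a] //=; first by elim: a.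
by rewrite IH addnS.
Qed.

Lemma ftilde_betas (d M s : nat) (i : int) (la : bipart) (p : nat) :
  0 < d -> bipart_ok la -> bounded M s la -> good (wletter d M s i la) p ->
  exists la', [/\ ftilde d (0%R, s%:Z%R) i la = Some la', bipart_ok la',
    rank la' = (rank la).+1
    & betas M s la' = bmove (betas M s la) p (offset d M i + p./2 * d).-1].
Proof.
move=> d0 ok bla /(ftilde_good d0 bla)[a [e hs ev]].
exists (set_component la (poscomp p) (incr_nth (component la (poscomp p)) a)).
move: hs ev; case: bla => s1 s2 l1 l2; case/andP: ok => p1 p2.
rewrite {}e /betas /bmove /rank /bipart_ok /poscomp /component /set_component /msize.
case: (odd p) => /= hs ev; split=> //=.
- by rewrite incr_part.
- by rewrite sumn_incr_nth addSn.
- by rewrite ev (@beta_incr M).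
- by rewrite p1 incr_part.
- by rewrite sumn_incr_nth addnS.
by rewrite ev (@beta_incr (M + s)).
Qed.

Lemma ftilde_ok (d s : nat) (i : int) (la la' : bipart) : 0 < d -> bipart_ok la ->
  ftilde d (0%R, s%:Z%R) i la = Some la' -> bipart_ok la' /\ rank la' = (rank la).+1.
Proof.
move=> d0 ok e; have bla := bounded_rank s ok (ltnSn _).
have [p gp] := ftilde_some d0 bla e.
by have [l [+ ? ? _]] := ftilde_betas d0 ok bla gp; rewrite e => -[->].
Qed.

Lemma Phi_ok (d s : nat) (la : bipart) : 0 < d -> Phi d (0%R,
  s%:Z%R) la -> bipart_ok la.
Proof.
move=> d0 [w]; elim: w la => [|i w IH] la /=; first by move=> [<-].
by case: foldr IH => [mu|//] IH /= e; have [] := ftilde_ok d0 (IH _ erefl) e.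
Qed.

Lemma beta_sorted_uniq (M : nat) (l : seq nat) : is_part l -> uniq (beta M l).
Proof. by move=> /andP[sl _]; apply/uniq_ltn/sorted_beta. Qed.

Lemma letter0 (X : seq nat) : letter X 0 = 0%R.
Proof. exact: subrr. Qed.

(** The word of [la] is cut into blocks (component 2 at [v], component 1 at [v]), that of [mu] into
    blocks (component 1 at [v], component 2 at [v + d]). [Psi_local] compares the blocks,
    [good_shift] then locates the good letter of [mu], and the moved sets are again related by
    [is_Psi]. *)
Lemma crystal_step (d M s : nat) (i : int) (la mu la' : bipart) :
  0 < d -> bipart_ok la -> bipart_ok mu -> bounded M s la -> bounded M (s + d) mu ->
  Psi d (betas M s la) = betas M (s + d) mu ->
  ftilde d (0%R, s%:Z%R) i la = Some la' ->
  exists mu', ftilde d (0%R, (s + d)%:Z%R) i mu = Some mu'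
    /\ Psi d (betas M s la') = betas M (s + d) mu'.
Proof.
move=> d0 ok ok' bla bmu e f.
set X1 := beta M la.1; set X2 := beta (M + s) la.2.
set Y := beta M mu.1; set W := beta (M + (s + d)) mu.2.
have [/andP[sl1 _] /andP[sl2 _]] := andP ok.
have u1 : uniq X1 by case/andP: ok => h _; apply: beta_sorted_uniq.
have u2 : uniq X2 by case/andP: ok => _ h; apply: beta_sorted_uniq.
have X10 : 0 \in X1 by case: bla => _ _ h _; apply: mem0_beta.
have sX : size X1 <= size X2 by rewrite !size_beta leq_addr.
have hP : is_Psi d X1 X2 Y W.
  by have := PsiP d u2 sX; rewrite -[(X1, X2)]/(betas M s la) e.
have [p gp] := ftilde_some d0 bla f.
set a := wletter d M s i la; set b := wletter d M (s + d) i mu.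
set v0 := offset d M i.
have aE k : a k.*2 = letter X2 (v0 + k * d).
  by rewrite /a /wletter /poscomp odd_double doubleK.
have aO k : a k.*2.+1 = letter X1 (v0 + k * d).
  by rewrite /a /wletter /poscomp /= odd_double /= uphalf_double.
have bO k : b k.*2.+1 = letter Y (v0 + k * d).
  by rewrite /b /wletter /poscomp /= odd_double /= uphalf_double.
have bE k : b k.*2.+2 = letter W (v0 + k * d + d).
  by rewrite /b /wletter /poscomp /= odd_double /= doubleK mulSn addnAC addnA.
(* Position 0 of the word of [mu] precedes all blocks; its letter vanishes since [v0 < d] and all
   numbers below [d] are in [W]. *)
have b0 : b 0 = 0%R.
  have := offset_lt M i d0; rewrite /b /wletter /= mul0n addn0 -/v0 => vd.
  case: hP => _ _ _ hW; rewrite /letter -/W !hW vd (leq_ltn_trans (leq_pred v0) vd) //.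
have loc k : (a k.*2 + a k.*2.+1 = b k.*2.+1 + b k.*2.+2)%R /\
    height2 (a k.*2) (a k.*2.+1) = height2 (b k.*2.+1) (b k.*2.+2).
  rewrite aE aO bO bE; case: (v0 + k * d) => [|u].
    by rewrite (letterW _ X10 hP) !letter0.
  by have [] := Psi_local u u1 u2 X10 hP.
have [act gF gS] := @good_shift a b p (is_letters_word _ _ _ _ _) (is_letters_word _
  _ _ _ _)
  b0 (fun k => (loc k).1) (fun k => (loc k).2) gp.
set k := p./2 in act gF gS; set v := v0 + k * d.
(* A letter at 0 vanishes, so the good letter forces [v] to be positive. *)
have vS : v = v.-1.+1.
  case ev: v => [|//]; move: act; rewrite aE aO -/v ev !letter0.
  by case: ifP.
have [_ _ h1 h2] := Psi_local v.-1 u1 u2 X10 hP; rewrite -vS in h1 h2.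
rewrite !aE !aO -/v in act.
rewrite bO bE -/v in gF gS.
have [la'' []] := ftilde_betas d0 ok bla gp.
rewrite f => -[<-] ok'' _ eb'.
(* Common conclusion of the four cases: [p'] is [k.*2.+1] if [Y] moves and [k.*2.+2] if [W]
   moves. *)
have key p' X1' X2' Y' W' : good b p' -> betas M s la' = (X1', X2') ->
    bmove (betas M (s + d) mu) p' (v0 + p'./2 * d).-1 = (Y', W') ->
    is_Psi d X1' X2' Y' W' ->
    exists mu', ftilde d (0%R, (s + d)%:Z%R) i mu = Some mu'
    /\ Psi d (betas M s la') = betas M (s + d) mu'.
  move=> gp' e1 e2 hP'; have [mu' [f' _ _ e3]] := ftilde_betas d0 ok' bmu gp'.
  exists mu'; split=> //; rewrite e3 e2; case: e1 => eX1 eX2.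
  rewrite /betas eX1 eX2; apply: is_Psi_eq => //; rewrite -?eX1 -?eX2 ?size_beta
    ?leq_addr //.
    by apply: sorted_beta; case/andP: ok'' => /andP[].
  by apply: sorted_beta; case/andP: ok'' => _ /andP[].
have eF : (v0 + k.*2.+1./2 * d).-1 = v.-1 by rewrite /= uphalf_double.
have eS : (v0 + k.*2.+2./2 * d).-1 = (v.-1 + d).
  by rewrite /= doubleK mulSn addnA [v0 + d]addnC -addnA -/v {1}vS addnS addnC.
rewrite /bmove -/k -/v0 -/v /betas /= in eb'.
case: (odd p) act eb' => act eb'.
- case: (h2 act) => -[act' hP'].
  + apply: (key k.*2.+1 _ _ _ _ (gF act') eb' _ hP').
    by rewrite eF /bmove /= odd_double.
  apply: (key k.*2.+2 _ _ _ _ (gS act') eb' _ hP').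
  by rewrite eS /bmove /= odd_double.
case: (h1 act) => -[act' hP'].
  apply: (key k.*2.+1 _ _ _ _ (gF act') eb' _ hP').
  by rewrite eF /bmove /= odd_double.
apply: (key k.*2.+2 _ _ _ _ (gS act') eb' _ hP').
by rewrite eS /bmove /= odd_double.
Qed.

Lemma beta_nil (m : nat) : beta m [::] = iota 0 m.
Proof. by rewrite /beta -[RHS]map_id; apply/eq_map => k; rewrite nth_nil. Qed.

Lemma rank0 (la : bipart) : bipart_ok la -> rank la = 0 -> la = empty_bipart.
Proof.
case: la => l1 l2 /andP[/= /size_part h1 /size_part h2].
by rewrite /rank /=; case: l1 l2 h1 h2 => [|x l1] [|y l2] //=; lia.
Qed.

(** On [Phi] the map [psi] is determined by the empty bipartition and commutation with [ftilde]; by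
    [crystal_step] the map [Psi] follows the same rule. At the start the beta sets are nested
    intervals, handled by [Psi_subset]. *)
Lemma psi_Psi (d M s : nat) (psi : bipart -> bipart) (la : bipart) :
  0 < d -> crystal_iso d (0%R, s%:Z%R) psi -> Phi d (0%R, s%:Z%R) la -> rank la < M ->
  Psi d (betas M s la) = betas M (s + d) (psi la).
Proof.
move=> d0; rewrite /crystal_iso /= -PoszD => -[[hb _ _] hr hf _] [w].
have Pok mu : Phi d (0%R, s%:Z%R) mu -> bipart_ok (psi mu).
  by move=> h; apply: (Phi_ok d0 (s := s + d)); apply: hb.
elim: w la => [|i w IH] la /=.
  move=> [<-] _.
  have h0 : Phi d (0%R, s%:Z%R) empty_bipart by exists [::].
  rewrite (rank0 (Pok _ h0)); last by rewrite hr.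
  rewrite /betas /= !beta_nil; apply: Psi_subset; rewrite ?iota_ltn_sorted //.
    by move=> t; rewrite !mem_iota; lia.
  by move=> t; rewrite !mem_iota; lia.
case emu: foldr => [mu|//] /= f rM.
have hmu : Phi d (0%R, s%:Z%R) mu by exists w.
have ok := Phi_ok d0 hmu.
have [okl rl] := ftilde_ok d0 ok f.
have rmu : rank mu < M by lia.
have := crystal_step d0 ok (Pok _ hmu) (bounded_rank s ok rmu)
  (bounded_rank (s + d) (Pok _ hmu) _) (IH _ emu rmu) f.
rewrite hr // => /(_ rmu)[mu' [f' ->]].
by have := hf i _ hmu; rewrite f /= f' => -[->].
Qed.

(** * Regular partitions *)

Lemma psum_eq (a b : nat -> int) (q : nat) :
  (forall t, t < q -> a t = b t) -> psum a q = psum b q.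
Proof.
by elim: q => [//|q IH] h /=; rewrite h ?ltnSn // IH // => t tq; apply/h/ltnW.
Qed.

Lemma good_eq (a b : nat -> int) (p : nat) : a =1 b -> good a p -> good b p.
Proof.
move=> e [ap h1 h2]; have E q : psum b q = psum a q by apply/esym/psum_eq.
by split=> [|q|q]; rewrite ?E -?e; [|apply: h1|apply: h2].
Qed.

(** With every letter doubled, partial sums double at even indices, and the rightmost surviving 1 is
    the second copy of the good letter. *)
Lemma good_double_fst (a c : nat -> int) (m : nat) : is_letters c ->
  (forall k, a k.*2 = c k /\ a k.*2.+1 = c k) -> good c m -> good a m.*2.+1.
Proof.
move=> lc h [cm h1 h2].
have E k : psum a k.*2 = (psum c k *+ 2)%R.
  elim: k => [//|k IH]; rewrite doubleS /= -/(psum a k.*2) IH.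
  by case: (h k) => -> ->; clear; lia.
have E' k : psum a k.*2.+1 = (psum c k *+ 2 + c k)%R.
  by rewrite /= E; case: (h k) => ->.
have F q : q <= m.*2.+1 -> (psum a q <= psum a m.*2.+1)%R.
  rewrite E' cm => qm; have [e|e] : q = q./2.*2 \/ q = q./2.*2.+1 by clear; lia.
    rewrite e E; have : q./2 <= m by move: qm; clear; lia.
    by move/h1; clear; lia.
  rewrite e E'; have : q./2 <= m by move: qm; clear; lia.
  by move/h1; move: (lc q./2); clear; lia.
split=> //; first by case: (h m) => _ ->.
move=> q qm; have -> : psum a m.*2.+2 = (psum c m.+1 *+ 2)%R by rewrite -doubleS E.
have [e|e] : q = q./2.*2 \/ q = q./2.*2.+1 by clear; lia.
  rewrite e E; have : m < q./2 by move: qm e; clear; lia.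
  by move/h2; clear; lia.
rewrite e E'; have mq : m < q./2 by move: qm e; clear; lia.
move: (h2 _ mq) (h2 _ (leqW mq)) => /=.
by move: (lc q./2); clear; lia.
Qed.

(** The situation after the second copy has been used: it has become -1, partial sums beyond block
    [m] drop by 2, and the maximum is now first reached after the first copy. *)
Lemma good_double_snd (a c : nat -> int) (m : nat) : is_letters c ->
  (forall k, a k.*2 = c k /\ a k.*2.+1 = if k == m then (-1)%R else c k) ->
  good c m -> good a m.*2.
Proof.
move=> lc h [cm h1 h2].
have E k : psum a k.*2 = (psum c k *+ 2 - (m < k)%:R *+ 2)%R.
  elim: k => [//|k IH]; rewrite doubleS /= -/(psum a k.*2) IH ltnS.
  case: (h k) => -> ->; case: (ltngtP m k) => [mk|mk|<-] /=; rewrite ?cm.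
  - by clear; lia.
  - by clear; lia.
  - by clear; lia.
have E' k : psum a k.*2.+1 = (psum c k *+ 2 - (m < k)%:R *+ 2 + c k)%R.
  by rewrite /= E; case: (h k) => ->.
split; first by case: (h m) => ->.
- move=> q qm; rewrite E ltnn.
  have [e|e] : q = q./2.*2 \/ q = q./2.*2.+1 by clear; lia.
    rewrite e E; have qm' : q./2 <= m by move: qm; clear; lia.
    by rewrite ltnNge qm' /=; move: (h1 _ qm'); clear; lia.
  rewrite e E'; have qm' : q./2 < m by move: qm e; clear; lia.
  rewrite ltnNge (ltnW qm') /=; move: (h1 _ (ltnW qm')) (h1 _ qm') => /=.
  by move: (lc q./2); clear; lia.
move=> q qm; rewrite E' ltnn cm.
have [e|e] : q = q./2.*2 \/ q = q./2.*2.+1 by clear; lia.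
  rewrite e E; have mq : m < q./2 by move: qm e; clear; lia.
  by rewrite mq; move: (h2 _ mq) => /=; rewrite cm; clear; lia.
rewrite e E'; case: (ltngtP m q./2) => mq.
- move: (h2 _ mq) (h2 _ (leqW mq)) => /=; rewrite cm.
  by move: (lc q./2); clear; lia.
- by exfalso; move: qm e mq; clear; lia.
by rewrite -mq cm; clear; lia.
Qed.

Lemma good_delay (a c : nat -> int) (m : nat) :
  a 0 = 0%R -> (forall k, a k.+1 = c k) -> good c m -> good a m.+1.
Proof.
move=> a0 h [cm h1 h2].
have E k : psum a k.+1 = psum c k.
  by elim: k => [|k IH]; rewrite /= ?a0 // -/(psum a k.+1) IH h.
split; first by rewrite h.
  by move=> [|q] qm; rewrite E; [exact: (h1 0) | rewrite E h1].
by move=> [//|q] qm; rewrite !E h2.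
Qed.

Lemma letter_mv (u : nat) (X : seq nat) (t : nat) : u \in X ->
  t != u -> t != u.+1 -> t != u.+2 -> letter (mv u X) t = letter X t.
Proof.
move=> uX t0 t1 t2; rewrite /letter !mem_mv //.
have -> : t.-1 != u by move: t0 t1; clear; lia.
have /negbTE-> : t.-1 != u.+1 by move: t1 t2; clear; lia.
by rewrite t0 (negbTE t1).
Qed.

Lemma letter_mv_at (u : nat) (X : seq nat) : u \in X -> letter (mv u X) u.+1 = (-1)%R.
Proof.
move=> uX; rewrite /letter !mem_mv //= !eqxx /=.
by have -> : u.+1 != u by clear; lia.
Qed.

(* For the beta numbers X of a partition: no nonzero part occurs e times. *)
Definition beta_regular (e : nat) (X : seq nat) : Prop :=
  forall v, v \notin X -> exists2 t, 0 < t <= e & v + t \notin X.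

Lemma d_regular_nth (e : nat) (l : seq nat) (a : nat) : 0 < e -> is_part l ->
  d_regular e l -> 0 < nth 0 l a -> nth 0 l (a + e.-1) < nth 0 l a.
Proof.
move=> e0 /andP[sl _] /allP hreg la; set x := nth 0 l a.
rewrite ltnNge; apply/negP => hx.
have sz : a + e.-1 < size l.
  by rewrite ltnNge; apply/negP => h; rewrite nth_default // in hx; move: la hx;
    rewrite -/x; clear; lia.
have as_ : a < size l by apply: leq_ltn_trans sz; rewrite leq_addr.
have := hreg x (mem_nth 0 as_); rewrite ltnNge => /negP; apply.
rewrite -(cat_take_drop a l) -(cat_take_drop e (drop a l)) !count_cat.
have st : size (take e (drop a l)) = e.
  by rewrite size_take size_drop; case: ifP => //; move: sz; clear -e0; lia.
have /eqP-> : count (pred1 x) (take e (drop a l)) == size (take e (drop a l)).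
  rewrite -all_count.
  apply/(all_nthP 0) => j; rewrite st => je /=; rewrite nth_take // nth_drop.
  rewrite eqn_leq (nth_geq sl (leq_addr _ _)) (leq_trans hx) //.
  by apply: nth_geq => //; move: je; clear; lia.
by rewrite st; clear; lia.
Qed.

(** Beta numbers that follow each other without a gap belong to consecutive rows with equal parts,
    so a run of length [e] after a gap gives [e] equal parts. *)
Lemma d_regular_beta (e M : nat) (l : seq nat) : 0 < e -> is_part l ->
  size l < M -> d_regular e l -> beta_regular e (beta M l).
Proof.
move=> e0 pl lM hreg v vX; have /andP[sl _] := pl.
case: (boolP (has (fun t => v + t \notin beta M l) (iota 1 e))).
  by case/hasP => t; rewrite mem_iota => ht hX; exists t => //; move: ht; clear; lia.
move=> /hasPn h; exfalso.
have {}h t : 0 < t <= e -> v + t \in beta M l.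
  by move=> ht; have := h t; rewrite mem_iota negbK; apply; move: ht; clear; lia.
have /betaP[b bM eb] := h 1 (introT andP (conj isT e0)).
have run t : t < e -> t <= b /\ v + t.+1 = nth 0 l (b - t) + (M - (b - t).+1).
  elim: t => [_|t IH te]; first by rewrite subn0.
  have [tb et] := IH (ltnW te); have /betaP[c cM ec] : v + t.+2 \in beta M l
    by apply: h; move: te; clear; lia.
  have cr : c < b - t.
    rewrite ltnNge; apply/negP => hc; have := nth_geq sl hc.
    by move: et ec hc cM bM; clear; lia.
  have tb' : t < b by move: cr; clear; lia.
  split=> //.
  have h1 : c <= b - t.+1 by move: cr; clear; lia.
  have h2 : b - t.+1 <= b - t by clear; lia.
  have n1 := nth_geq sl h1; have n2 := nth_geq sl h2.
  by move: n1 n2 et ec h1 tb' bM; clear; lia.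
have [eb1 eb2] : e.-1 <= b /\ v + e = nth 0 l (b - e.-1) + (M - (b - e.-1).+1).
  by have := run e.-1; rewrite prednK // => /(_ (leqnn _)).
have := @d_regular_nth e l (b - e.-1) e0 pl hreg; rewrite subnK //.
(* If these parts are zero, [v] is itself the beta number of the next row and thus no gap. *)
case: (posnP (nth 0 l (b - e.-1))) => [z _|_ /(_ isT)]; last first.
  by move: eb eb2 eb1 bM e0; clear; lia.
have zb : nth 0 l b = 0.
  by have := nth_geq sl (leq_subr e.-1 b); rewrite z leqn0 => /eqP.
case/negP: vX; apply/betaP; exists b.+1; first by move: eb; rewrite zb; clear; lia.
have -> : nth 0 l b.+1 = 0.
  by have := nth_geq sl (leqnSn b); rewrite zb leqn0 => /eqP.
by move: eb; rewrite zb; clear; lia.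
Qed.

(** The version for removable nodes: the leftmost surviving -1 sits at the last index where the
    partial sums are maximal. *)
Lemma last_argmax (S : nat -> int) (N : nat) : exists2 m, m <= N &
  (forall q, q <= N -> (S q <= S m)%R) /\
  (forall q, m < q -> q <= N -> (S q < S m)%R).
Proof.
elim: N => [|N [m mN [h1 h2]]].
  by by exists 0 => //; split=> [q|[|q]] //; rewrite leqn0 => /eqP->.
case: (lerP (S m) (S N.+1)) => h.
  exists N.+1 => //; split=> q; last by move=> q1 q2; move: (leq_trans q1 q2);
    rewrite ltnn.
  by rewrite leq_eqVlt => /predU1P[->//|]; rewrite ltnS => /h1 /le_trans/(_ h).
exists m; first exact: leqW.
split=> [q|q mq]; rewrite leq_eqVlt => /predU1P[->//|]; rewrite ?ltnS.
- exact: ltW.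
- exact: h1.
exact: h2.
Qed.

Lemma nth_trim (l : seq nat) (a : nat) : sorted geq l ->
  nth 0 (trim l) a = nth 0 l a.
Proof.
elim: l a => [//|x l IH] a sl /=; have sl' : sorted geq l := path_sorted sl.
case: (posnP x) => [x0|x0]; last by case: a => [//|a]; apply: IH.
have z b : nth 0 (x :: l) b = 0.
  by have := nth_geq sl (leq0n b); rewrite [nth 0 _ 0]/= x0 leqn0 => /eqP.
rewrite z IH //; exact: (z a.+1).
Qed.

Lemma trim_part (l : seq nat) : sorted geq l -> is_part (trim l).
Proof.
move=> sl; rewrite /is_part mem_filter ltnn /= andbT; apply: sorted_filter => //.
by move=> x y z /= h1 h2; apply: leq_trans h2 h1.
Qed.

Lemma removal (M : nat) (l : seq nat) (v : nat) : is_part l -> size l < M ->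
  letter (beta M l) v = (-1)%R ->
  exists l', [/\ is_part l', size l' < M, sumn l = (sumn l').+1, 0 < v
    & beta M l = mv v.-1 (beta M l') /\ letter (beta M l') v = 1%R].
Proof.
move=> pl lM; have /andP[sl _] := pl.
case/(letter_remP sl lM) => a [l0 hs ev].
have al : a < size l.
  by rewrite ltnNge; apply/negP => h; rewrite nth_default in l0.
set l' := trim (decr_nth l a); have pl' : is_part l' := trim_part hs.
have n' b : nth 0 l' b = nth 0 l b - (a == b) by rewrite nth_trim // nth_decr_nth.
have el : sorted geq (incr_nth l' a).
  apply/sorted_geqP => b; rewrite !nth_incr_nth !n'.
  have := elimT (sorted_geqP l) sl b; move: l0.
  case: (eqVneq a b.+1) => [ab|_].
    by rewrite ab gtn_eqF //; clear; lia.
  by case: (eqVneq a b) => [->|_]; clear; lia.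
have e : l = incr_nth l' a.
  apply: part_ext => //; first exact: incr_part.
  move=> b; rewrite nth_incr_nth n'; case: eqP => [<-|_]; rewrite ?subn0 //.
  by move: l0; clear; lia.
have sl' : size l' < M.
  apply: leq_ltn_trans lM; rewrite leqNgt; apply/negP => h.
  have := n' (size l); rewrite [X in _ = X - _]nth_default // sub0n => z.
  by case/andP: pl' => _ /negP; apply; rewrite -z mem_nth.
have ev' : v = nth 0 l' a + (M - a) by rewrite n' eqxx ev; move: l0 al lM; clear; lia.
have sl'' : sorted geq l' by case/andP: pl'.
exists l'; split=> //.
- by rewrite {1}e sumn_incr_nth.
- by move: ev l0; clear; lia.
by rewrite {1}e (beta_incr sl'') // -ev' ev' (letter_add sl'').
Qed.

(** Let [g] be the last gap below the largest beta number [L]. In the residue class of [g.+1] the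
    last nonzero letter is the -1 at [g.+1], so a -1 survives the cancellations; the leftmost
    surviving one is the node to remove. *)
Lemma good_removal (e M : nat) (l : seq nat) : 1 < e -> is_part l -> size l < M ->
  beta_regular e (beta M l) -> l != [::] ->
  exists l' v0 m, let v := v0 + m * e in
  [/\ is_part l', size l' < M, sumn l = (sumn l').+1, beta_regular e (beta M l')
    & [/\ v0 < e, 0 < v, beta M l = mv v.-1 (beta M l'), letter (beta M l') v = 1%R
      & good (fun k => letter (beta M l') (v0 + k * e)) m]].
Proof.
move=> e1 pl lM hreg l0; have /andP[sl n0] := pl; set X := beta M l.
have x0 : 0 < nth 0 l 0.
  by case: (l) l0 n0 => [//|x r] _; rewrite inE negb_or => /andP[]; case: x.
have M0 : 0 < M by apply: leq_ltn_trans lM.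
set L := nth 0 l 0 + M.-1.
have LX : L \in X by apply/betaP; exists 0 => //; rewrite /L subn1.
have maxL t : t \in X -> t <= L.
  by case/betaP => a aM ->; have := nth_geq sl (leq0n a); rewrite /L; move: aM;
    clear; lia.
(* The [M] elements of [X] cannot fill the interval up to [L], because the largest part is
   positive. *)
have exg : exists g, (g \notin X) && (g < L).
  case: (boolP (has (fun g => g \notin X) (iota 0 L))).
    by case/hasP => g; rewrite mem_iota /= add0n => gL gX; exists g; rewrite gX.
  move=> /hasPn h; exfalso.
  have sub : {subset iota 0 L.+1 <= X}.
    move=> t; rewrite mem_iota /= add0n ltnS leq_eqVlt => /predU1P[->//|tL].
    by have := h t; rewrite mem_iota /= add0n negbK; apply.
  have := uniq_leq_size (iota_uniq 0 L.+1) sub; rewrite size_iota size_beta /L.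
  by move: x0 M0; clear; lia.
have ubg g : (g \notin X) && (g < L) -> g <= L by case/andP=> _ /ltnW.
case: (ex_maxnP exg ubg) => g /andP[gX gL] gmax.
have runX t : g < t -> t <= L -> t \in X.
  move=> gt; rewrite leq_eqVlt => /predU1P[->//|tL]; apply/negPn/negP => tX.
  by have := gmax t; rewrite tX tL leqNgt gt => /(_ isT).
have Lge : L < g + e.
  have [t /andP[t0 te] tX] := hreg g gX.
  rewrite ltnNge; apply/negP => h; case/negP: tX; apply: runX; move: t0 te h; clear;
    lia.
set v0 := g.+1 %% e; set n := g.+1 %/ e.
have v0e : v0 < e by rewrite ltn_mod; move: e1; clear; lia.
have eg : v0 + n * e = g.+1 by rewrite addnC -divn_eq.
set c := fun k => letter X (v0 + k * e).
have lc : is_letters c by move=> t; apply: letter_values.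
have cn : c n = (-1)%R.
  by rewrite /c eg /letter /= (negbTE gX) runX.
(* Regularity at the gap [g] gives [L < g + e], so one period above [g.+1] all beta numbers have
   been passed. *)
have cbig k : n < k -> c k = 0%R.
  move=> nk; rewrite /c; have : g.+1 + e <= v0 + k * e.
    by rewrite -eg -addnA leq_add2l addnC -mulSn leq_mul2r nk orbT.
  move: (v0 + k * e) => t ht; rewrite /letter.
  have t1 : t \notin X by apply/negP => /maxL; move: ht Lge; clear; lia.
  have t2 : t.-1 \notin X by apply/negP => /maxL; move: ht Lge e1; clear; lia.
  by rewrite (negbTE t1) (negbTE t2).
have [m mn [h1 h2]] := last_argmax (psum c) n.+1.
have Sn : psum c n.+1 = (psum c n - 1)%R by rewrite /= cn.
have cst q : n < q -> psum c q = psum c n.+1.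
  by move=> nq; apply: psum_const nq => t /cbig.
have {}mn : m <= n.
  move: mn; rewrite leq_eqVlt => /predU1P[em|//].
  by have := h1 n (leqnSn n); rewrite em Sn; clear; lia.
have hlt q : m < q -> (psum c q < psum c m)%R.
  move=> mq; case: (leqP q n.+1) => [/h2->//|/ltnW qn].
  by rewrite cst // h2.
have hle q : q <= m -> (psum c q <= psum c m)%R by move=> qm; apply: h1; move: qm mn;
  clear; lia.
have cm : c m = (-1)%R.
  have := hlt m.+1 (ltnSn m); rewrite /=; move: (lc m); clear; lia.
have [l' [pl' sl' sm v0' [eX l1]]] := removal pl lM cm.
exists l', v0, m => v; rewrite -/v in eX l1 v0' *.
set X' := beta M l' in eX l1 *.
have [uX' vX'] : v.-1 \in X' /\ v \notin X'.
  by move: l1; rewrite /letter; case: (v.-1 \in X'); case: (v \in X').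
have vS : v.-1.+1 = v by rewrite prednK.
have memX t : (t \in X) = (t != v.-1) && ((t == v) || (t \in X')).
  by rewrite /X eX mem_mv // vS.
have c'E k : k != m -> letter X' (v0 + k * e) = c k.
  move=> km; rewrite /c /X eX letter_mv ?vS //; apply/eqP => h; move: km;
    rewrite neq_ltn => /orP[km|km];
    have := leq_mul km (leqnn e); move: h v0' e1; rewrite /v mulSn; clear; lia.
split=> //.
(* Suppose the gap [w] of [X'] is followed by [e] elements. If [w = v], the gap [v.-1] of [X] would
   be followed by [e] elements too; otherwise the run must use the new element [v.-1], and end there
   since [v] is a gap of [X']. *)
- move=> w wX'.
  case: (boolP (has (fun t => w + t \notin X') (iota 1 e))).
    by case/hasP => t; rewrite mem_iota => ht hX; exists t => //; move: ht; clear; lia.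
  move=> /hasPn h; exfalso.
  have {}h t : 0 < t <= e -> w + t \in X'.
    by move=> ht; have := h t; rewrite mem_iota negbK; apply; move: ht; clear; lia.
  case: (eqVneq w v) => [wv|wv].
    have uX : v.-1 \notin X by rewrite memX eqxx.
    have [t /andP[t0 te]] := hreg _ uX; rewrite memX => /negP; apply.
    case: t t0 te => [//|t] _ te; have -> : v.-1 + t.+1 = v + t by rewrite -vS addnS.
    case: t te => [|t] te; first by rewrite addn0 eqxx andbT; move: v0'; clear; lia.
    rewrite -wv h ?orbT ?andbT; last by move: te; clear; lia.
    by rewrite wv; move: v0'; clear; lia.
  have wX : w \notin X.
    by rewrite memX (negbTE wv) (negbTE wX') andbF.
  have [t /andP[t0 te]] := hreg _ wX; rewrite memX h ?t0 // orbT andbT negbK => /eqP wt.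
  have te' : t = e.
    apply/eqP; rewrite eqn_leq te leqNgt; apply/negP => tlt.
    have := h t.+1; rewrite addnS wt vS (negbTE vX').
    by move: tlt; clear; lia.
  move: wt; rewrite te' => wt.
  have wv' : w.+1 + e = v by rewrite addSn wt vS.
  have w1X : w.+1 \in X.
    rewrite memX -addn1 h ?orbT ?andbT; last by move: e1; clear; lia.
    by rewrite -wt eqn_add2l; move: e1; clear; lia.
  have m0 : 0 < m.
    by rewrite lt0n; apply/eqP => mz; move: wv' v0e; rewrite /v mz; clear; lia.
  (* One period below [v] there would be another -1, at [w.+1], and the partial sum at [m.-1] would
     exceed the maximum, taken at [m]. *)
  have cm1 : c m.-1 = (-1)%R.
    rewrite /c; have -> : v0 + m.-1 * e = w.+1.
      apply/eqP; rewrite -(eqn_add2r e) wv' /v -addnA [m.-1 * e + e]addnC -mulSn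
        prednK //.
    by rewrite /letter w1X /= (negbTE wX).
  have := hle m.-1 (leq_pred m); rewrite -{2}(prednK m0) /= cm1.
  by clear; lia.
split=> //; set c' := fun k => letter X' (v0 + k * e).
have S1 q : q <= m -> psum c' q = psum c q.
  by move=> qm; apply: psum_eq => t tq; apply: c'E; move: qm tq; clear; lia.
have S2 q : m < q -> psum c' q = (psum c q + 2)%R.
  elim: q => [//|q IH]; rewrite ltnS leq_eqVlt => /predU1P[<-|mq].
    by rewrite /= S1 // cm [c' m]l1; clear; lia.
  by rewrite /= IH // [c' q]c'E ?gtn_eqF //; clear; lia.
split=> // q qm; first by rewrite !S1 ?hle.
by rewrite !S2 //= cm; have := hlt q qm; clear; lia.
Qed.

(** * Doubled partitions as Uglov bipartitions *)

Lemma mem_beta_widen (M e : nat) (l : seq nat) (t : nat) : size l <= M ->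
  (t \in beta (M + e) l) = (t < e) || (t - e \in beta M l).
Proof.
move=> lM; apply/betaP/orP => [[a aM et]|[te|/betaP[a aM et]]].
- case: (leqP M a) => Ma.
    by left; move: et; rewrite nth_default ?(leq_trans lM) //; move: aM Ma; clear; lia.
  by right; apply/betaP; exists a => //; move: et aM Ma; clear; lia.
- exists (M + e - t.+1); first by move: te; clear; lia.
  by rewrite nth_default; move: te lM; clear; lia.
case: (ltnP t e) => te; last by exists a; move: et aM te; clear; lia.
exists (M + e - t.+1); first by move: te; clear; lia.
by rewrite nth_default; move: te lM; clear; lia.
Qed.

Lemma letter_widen (M e : nat) (l : seq nat) (t : nat) : size l < M ->
  letter (beta (M + e) l) (t + e) = letter (beta M l) t.
Proof.
move=> lM; rewrite /letter !mem_beta_widen ?(ltnW lM) // addnK.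
case: t => [|t].
  rewrite add0n ltnn /= (mem0_beta lM).
  by case: e => [|e] /=; rewrite ?ltnSn ?(mem0_beta lM).
by rewrite addSn /= addnK ltnNge leq_addl ltnNge -addSn leq_addl.
Qed.

Lemma letter_widen_lt (M e : nat) (l : seq nat) (t : nat) : size l <= M -> t < e ->
  letter (beta (M + e) l) t = 0%R.
Proof.
move=> lM te; rewrite /letter !mem_beta_widen // te.
by rewrite (leq_ltn_trans (leq_pred t) te).
Qed.

Lemma Phi_ftilde (d : nat) (s : int * int) (i : int) (la la' : bipart) :
  Phi d s la -> ftilde d s i la = Some la' -> Phi d s la'.
Proof. by move=> [w hw] f; exists (i :: w); rewrite /= hw. Qed.

Lemma betas_inj (M s : nat) (la la' : bipart) : bipart_ok la -> bipart_ok la' ->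
  rank la <= M -> rank la' <= M -> betas M s la = betas M s la' -> la = la'.
Proof.
case: la => l1 l2; case: la' => l1' l2' /andP[/= p1 p2] /andP[/= p1' p2'].
rewrite /rank /betas /= => r r' [e1 e2].
have := size_part p1; have := size_part p2.
have := size_part p1'; have := size_part p2' => h1 h2 h3 h4.
congr pair; [apply: beta_inj e1 | apply: beta_inj e2] => //;
  by move: h1 h2 h3 h4 r r'; clear; lia.
Qed.

Lemma ftilde_to (d M s : nat) (i : int) (la la' : bipart) (p : nat) :
  0 < d -> bipart_ok la -> bipart_ok la' -> rank la < M -> rank la' <= M ->
  good (wletter d M s i la) p ->
  betas M s la' = bmove (betas M s la) p (offset d M i + p./2 * d).-1 ->
  ftilde d (0%R, s%:Z%R) i la = Some la'.
Proof.
move=> d0 ok ok' r r' gp e.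
have [mu [-> okm rm em]] := ftilde_betas d0 ok (bounded_rank s ok r) gp.
by congr Some; apply: (@betas_inj M s _ _ okm ok' _ r'); rewrite ?rm // em e.
Qed.

Lemma offset_val (d M v : nat) : offset d M (v%:Z - M%:Z)%R = v %% d.
Proof. by rewrite /offset subrK modz_nat. Qed.

(** The second beta set is a level 1 beta set shifted by [e], so the word modulo [2 * e] runs
    through one level 1 word modulo [e], changing component at each letter. The boolean [b] tells
    that the class starts in component 1: position 0 is then below [e], where component 2 has no
    letter. *)
Lemma wletter_half (e M : nat) (i : int) (l1 l2 : seq nat) (v0 : nat) (b : bool) :
  size l2 < M -> v0 < e -> offset (2 * e) M i = v0 + ~~ b * e ->
  (b -> wletter (2 * e) M e i (l1, l2) 0 = 0%R) /\
  forall k, wletter (2 * e) M e i (l1, l2) (b + k)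
    = letter (beta M (if odd (b + k) then l1 else l2)) (v0 + k * e).
Proof.
move=> lM v0e off; split=> [hb|k].
  by rewrite /wletter off hb /= mul0n !addn0 letter_widen_lt // ltnW.
rewrite /wletter off /poscomp; set q := b + k.
have E : ~~ b * e + q./2 * (2 * e) = (k + ~~ odd q) * e.
  by rewrite mulnA -mulnDl; congr muln; rewrite /q; case: (b); clear; lia.
rewrite -addnA E /bset /component /msize; case: (odd q) => /=; first by rewrite addn0.
by rewrite mulnDl mul1n addnA letter_widen.
Qed.

Section Doubling.

Variables (e M : nat) (l l' : seq nat) (v0 m : nat).
Let v := v0 + m * e.
Let c k := letter (beta M l') (v0 + k * e).
Hypotheses (e1 : 1 < e) (pl : is_part l) (pl' : is_part l').
Hypotheses (rl : sumn l + sumn l < M) (sm : sumn l = (sumn l').+1).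
Hypotheses (v0e : v0 < e) (vpos : 0 < v).
Hypotheses (eX : beta M l = mv v.-1 (beta M l')) (lv : letter (beta M l') v = 1%R).
Hypothesis gc : good c m.

Let e0 : 0 < e. Proof. exact: ltnW. Qed.

Let lM : size l < M.
Proof. by have := size_part pl; move: rl; clear; lia. Qed.

Let lM' : size l' < M.
Proof. by have := size_part pl'; move: rl sm; clear; lia. Qed.

Let uX : v.-1 \in beta M l'.
Proof. by move: lv; rewrite /letter; case: (v.-1 \in _) => //; case: (v \in _). Qed.

Let lc : is_letters c.
Proof. by move=> t; apply: letter_values. Qed.

Let letter_new k : letter (beta M l) (v0 + k * e) = if k == m then (-1)%R else c k.
Proof.
rewrite eX; case: (eqVneq k m) => [->|km].
  by rewrite -/v -[X in letter _ X](prednK vpos) letter_mv_at.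
have vS : v.-1.+1 = v by rewrite prednK.
rewrite letter_mv ?vS //; apply/eqP => h; move: km; rewrite neq_ltn => /orP[km|km];
  have := leq_mul km (leqnn e); move: h vpos e1; rewrite /v mulSn; clear; lia.
Qed.

Let ok : bipart_ok (l, l). Proof. by rewrite /bipart_ok pl. Qed.
Let ok' : bipart_ok (l', l'). Proof. by rewrite /bipart_ok pl'. Qed.
Let ok1 : bipart_ok (l, l'). Proof. by rewrite /bipart_ok pl. Qed.
Let r0 : rank (l, l) <= M. Proof. exact: ltnW. Qed.
Let r1 : rank (l, l') < M. Proof. by rewrite /rank /=; move: rl sm; clear; lia. Qed.
Let r2 : rank (l', l') < M. Proof. by rewrite /rank /=; move: rl sm; clear; lia. Qed.

(** One residue is used twice: first for the second copy of the good letter, in component 1, then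
    for the first copy, in component 2. *)
Lemma Phi_double : Phi e (0%R, 0%R) (l', l') -> Phi e (0%R, 0%R) (l, l).
Proof.
move=> h; have off : offset e M (v%:Z - M%:Z)%R = v0.
  by rewrite offset_val /v addnC modnMDl modn_small.
have ev p : p./2 = m -> offset e M (v%:Z - M%:Z)%R + p./2 * e = v by move=> ->;
  rewrite off.
have f1 : ftilde e (0%R, 0%:Z%R) (v%:Z - M%:Z)%R (l', l') = Some (l, l').
  apply: (@ftilde_to e M 0 _ _ _ m.*2.+1) => //; first exact: ltnW r1.
    apply: (good_double_fst lc) gc => k; rewrite /wletter /poscomp off /= odd_double /=.
    by rewrite doubleK uphalf_double /bset /component /msize /= addn0.
  by rewrite ev /= ?uphalf_double // /bmove /betas /= odd_double /= eX.
have f2 : ftilde e (0%R, 0%:Z%R) (v%:Z - M%:Z)%R (l, l') = Some (l, l).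
  apply: (@ftilde_to e M 0 _ _ _ m.*2) => //.
    apply: (good_double_snd lc) gc => k; rewrite /wletter /poscomp off /= odd_double /=.
    by rewrite doubleK uphalf_double /bset /component /msize /= addn0 letter_new.
  by rewrite ev ?doubleK // /bmove /betas /= odd_double /= addn0 eX.
exact: Phi_ftilde (Phi_ftilde h f1) f2.
Qed.

Let good_half (a : nat -> int) (b : bool) :
  (b -> a 0 = 0%R) -> (forall k, a (b + k) = c k) -> good a (b + m).
Proof.
case: b => h0 h; first exact: (good_delay (h0 isT) h).
by apply: good_eq gc => k; rewrite -h.
Qed.

Let off1 : v %% (2 * e) = v0 + ~~ ~~ odd m * e.
Proof.
rewrite negbK /v -{1}(odd_double_half m) mulnDl addnA -muln2 -mulnA addnC modnMDl.
by rewrite modn_small //; case: (odd m); move: v0e; clear; lia.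
Qed.

Let off2 : (v + e) %% (2 * e) = v0 + ~~ odd m * e.
Proof.
rewrite /v -{1}(odd_double_half m) mulnDl addnA -muln2 -mulnA addnAC addnC modnMDl.
case: (odd m) => /=; last by rewrite modn_small //; move: v0e; clear; lia.
by rewrite mul1n mul0n -addnA addnn -mul2n addnC modnDl addn0 modn_small //;
  move: v0e; clear; lia.
Qed.

Let half_val (b : bool) : (v0 + ~~ b * e) + (b + m)./2 * (2 * e)
  = v + ~~ odd (b + m) * e.
Proof.
rewrite /v -!addnA; congr addn; rewrite mulnA -!mulnDl; congr muln.
by case: b; clear; lia.
Qed.

(** Here the two additions have distinct residues, those of [v] and [v + e], because the second beta
    set is shifted by [e]. *)
Lemma Phi_double_half : Phi (2 * e) (0%R, e%:Z%R) (l', l') ->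
  Phi (2 * e) (0%R, e%:Z%R) (l, l).
Proof.
move=> h; have d0 : 0 < 2 * e by rewrite muln_gt0.
have o1 := offset_val (2 * e) M v; rewrite off1 in o1.
have o2 := offset_val (2 * e) M (v + e); rewrite off2 in o2.
have f1 : ftilde (2 * e) (0%R, e%:Z%R) (v%:Z - M%:Z)%R (l', l') = Some (l, l').
  have [w0 w1] := wletter_half l' lM' v0e o1.
  (* The delay [~~ odd m] makes the position odd, hence in component 1; below, [odd m] makes it
     even, hence in component 2. *)
  apply: (@ftilde_to (2 * e) M e _ _ _ (~~ odd m + m)) => //; first exact: ltnW r1.
    by apply: good_half => // k; rewrite w1 if_same.
  rewrite o1 half_val /bmove.
  have -> : odd (~~ odd m + m) by rewrite oddD; case: (odd m).
  by rewrite addn0 /betas /= eX.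
have f2 : ftilde (2 * e) (0%R, e%:Z%R) ((v + e)%:Z - M%:Z)%R (l, l') = Some (l, l).
  have [w0 w1] := wletter_half l lM' v0e o2.
  have om : odd (odd m + m) = false by rewrite oddD; case: (odd m).
  apply: (@ftilde_to (2 * e) M e _ _ _ (odd m + m)) => //.
    (* Component 1 already contains the new node, but differs from [l'] only at the letter of index
       [m], which this word reads in component 2. *)
    apply: good_half => // k; rewrite w1; case: ifP => // ok_.
    rewrite letter_new; case: eqP => // km.
    by rewrite km om in ok_.
  rewrite o2 half_val /bmove om mul1n /betas /=; congr pair.
  have sl' : sorted geq l' by case/andP: pl'.
  apply: sorted_ltn_eq.
  - by apply: sorted_beta; case/andP: pl.
  - apply: sorted_mv; last exact: sorted_beta.
    rewrite prednK; last by rewrite addn_gt0 vpos.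
    rewrite mem_beta_widen ?(ltnW lM') // addnK ltnNge leq_addl /=.
    by move: lv; rewrite /letter; case: (v \in _) => //; case: (v.-1 \in _).
  have eu : (v + e).-1 = v.-1 + e by rewrite -{1}(prednK vpos).
  have uX2 : (v + e).-1 \in beta (M + e) l'.
    by rewrite eu mem_beta_widen ?(ltnW lM') // addnK uX orbT.
  move=> t; rewrite (mem_mv _ uX2) !mem_beta_widen ?(ltnW lM) ?(ltnW lM')
    // eX (mem_mv _ uX).
  rewrite eu; case: (ltnP t e) => te /=.
    by rewrite orbT andbT; move: te; clear; lia.
  have -> : (t == v.-1 + e) = (t - e == v.-1) by move: te; clear; lia.
  by have -> : (t == (v.-1 + e).+1) = (t - e == v.-1.+1) by move: te; clear; lia.
exact: Phi_ftilde (Phi_ftilde h f1) f2.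
Qed.

End Doubling.

(** [M] is generalised before the induction on the rank: regularity is carried along on beta sets,
    whose size must not change while the partition shrinks. *)
Lemma regular_Phi (e : nat) (l : seq nat) : 1 < e -> is_part l -> d_regular e l ->
  Phi e (0%R, 0%R) (l, l) /\ Phi (2 * e) (0%R, e%:Z%R) (l, l).
Proof.
move=> e1 pl hreg; have e0 := ltnW e1.
have lM : size l < (sumn l + sumn l).+1 by have := size_part pl; clear; lia.
have := d_regular_beta e0 pl lM hreg.
have := leqnn (sumn l + sumn l).+1.
move: {2 3}(sumn l + sumn l).+1 => M rM {lM}hreg'; move: hreg' => {}hreg.
have [n hn] := ubnP (sumn l).
elim: n => // n IH in l pl rM hreg hn *.
case: (eqVneq l [::]) => [->|l0]; first by split; exists [::].
have lM : size l < M by have := size_part pl; move: rM; clear; lia.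
have [l' [v0 [m [pl' sl' sm hreg' [v0e v' eX lv gm]]]]] := good_removal e1 pl lM hreg
  l0.
have [||h1 h2] := IH l' pl' _ hreg' _.
- by move: rM sm; clear; lia.
- by move: hn sm; clear; lia.
by split; [apply: Phi_double gm h1 | apply: Phi_double_half gm h2].
Qed.

(** * Iterations *)

Lemma psi_comp_Psi (psi : nat -> int * int -> bipart -> bipart) (d M s : nat)
    (la : bipart) (j : nat) :
  0 < d -> (forall t, crystal_iso d t (psi d t)) ->
  Phi d (0%R, s%:Z%R) la -> rank la < M ->
  let mu := psi_comp psi d (0%R, s%:Z%R) j la in
  [/\ Phi d (0%R, (s + j * d)%:Z%R) mu, rank mu = rank la
    & betas M (s + j * d) mu = iter j (Psi d) (betas M s la)].
Proof.
move=> d0 Hpsi hla rM /=; elim: j => [|j [h r e]] /=; first by rewrite mul0n addn0.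
have Hj := Hpsi (0%R, (s + j * d)%:Z%R).
rewrite mulSnr addnA -e -(psi_Psi d0 Hj h) ?r // -PoszD.
case: Hj => -[hb _ _] hr _ _; split=> //; last by rewrite hr.
by move: (hb _ h); rewrite /= -PoszD.
Qed.

(** By [Psi_subset] the second beta set is only shifted and completed by an interval, which is what
    widening from [M + s] to [M + s + d] does for one and the same partition. *)
Lemma psi_fix (psi : bipart -> bipart) (d M s : nat) (la : bipart) :
  0 < d -> crystal_iso d (0%R, s%:Z%R) psi -> Phi d (0%R, s%:Z%R) la -> rank la < M ->
  {subset (betas M s la).1 <= (betas M s la).2} -> psi la = la.
Proof.
move=> d0 Hpsi h rM sub; have ok := Phi_ok d0 h.
have [s1 s2 _ l2] := bounded_rank s ok rM.
have [[hb _ _] hr _ _] := Hpsi.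
have okp : bipart_ok (psi la) by apply: (Phi_ok d0 (s := s + d)); rewrite PoszD;
  apply: hb.
apply: (@betas_inj M (s + d)) => //; rewrite ?hr // 1?ltnW //.
rewrite -(psi_Psi d0 Hpsi h rM); apply: Psi_subset => //; try exact: sorted_beta.
by move=> t; rewrite /betas /= addnA mem_beta_widen // ltnW.
Qed.

(** The matching does not depend on [d], so the first sets agree; on the left the second map only
    shifts, and two intervals of length [d] make up one of length [2 * d]. *)
Lemma Psi_twice (d : nat) (X1 X2 : seq nat) :
  sorted ltn X1 -> sorted ltn X2 -> size X1 <= size X2 ->
  {subset (Psi d (X1, X2)).1 <= (Psi d (X1, X2)).2} ->
  Psi d (Psi d (X1, X2)) = Psi (2 * d) (X1, X2).
Proof.
move=> s1 s2 sX sub; have u2 := uniq_ltn s2.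
have [sY sW _ hW] := PsiP d u2 sX.
have [_ sZ _ hZ] := PsiP (2 * d) u2 sX.
rewrite [Psi d (X1, X2)]surjective_pairing (Psi_subset sY sW sZ) //.
move=> t; rewrite hZ hW -subnDA addnn -mul2n.
have -> : (t < 2 * d) = (t < d) || (t - d < d) by clear; lia.
by rewrite -!orbA.
Qed.

(** The first set stays below [M + rank la], while the zero parts of the second component fill the
    interval below [M + s - size la.2]. *)
Lemma subset_betas (M s : nat) (la : bipart) : bipart_ok la ->
  (rank la).*2 <= s -> {subset (betas M s la).1 <= (betas M s la).2}.
Proof.
move=> /andP[p1 p2] rs t /betaP[a aM ->].
have h1 : nth 0 la.1 a <= sumn la.1.
  by elim: (la.1) a {p1 p2 rs aM} => [|x r IH] [|a] //=;
    rewrite ?leq_addr // (leq_trans (IH a)) // leq_addl.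
have h2 := size_part p2; rewrite /betas /=.
have -> : M + s = size la.2 + (M + s - size la.2) by move: rs h2; rewrite /rank;
  clear; lia.
rewrite mem_beta_widen //; apply/orP; left.
by move: rs h1 h2 aM; rewrite /rank; clear; lia.
Qed.

Theorem proposition5p3
  (psi : nat -> int * int -> bipart -> bipart)
  (Hpsi : forall (d : nat) (s : int * int), 2 <= d -> crystal_iso d s (psi d s))
  (e : nat) (he : 2 <= e)
  (HC : forall (d m : nat) (X : seq nat) (k : nat),
      1 <= d -> in_P m X -> odd k ->
      let: (X1, X2) := iter k.+1 (Psi d) (X, X) in {subset X1 <= X2})
  (la : seq nat) (hla : is_part la) (hreg : d_regular e la) :
  (forall k : nat, 0 < k ->
     psi_comp psi (2 * e) (0%R, e%:Z%R) k.+1 (la, la)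
     = psi_comp psi e (0%R, 0%R) (2 * k + 2) (la, la))
  /\ (exists mu : bipart,
        is_psi_tilde psi (2 * e) (0%R, e%:Z%R) (la, la) mu
        /\ is_psi_tilde psi e (0%R, 0%R) (la, la) mu).
Proof.
have e0 : 0 < e := ltnW he; have e20 : 0 < 2 * e by rewrite muln_gt0.
have [h1 h2] := regular_Phi he hla hreg.
set M := (rank (la, la)).+1; have rM : rank (la, la) < M by [].
have He t : crystal_iso e t (psi e t) by apply: Hpsi.
have H2e t : crystal_iso (2 * e) t (psi (2 * e) t) by apply: Hpsi;
  rewrite -[2]muln1 leq_mul.
set pc1 := psi_comp psi e (0%R, 0%R); set pc2 := psi_comp psi (2 * e) (0%R, e%:Z%R).
set X := beta M la; set A := fun j => iter j (Psi e) (X, X).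
have PA j : [/\ Phi e (0%R, (j * e)%:Z%R) (pc1 j (la, la)), rank (pc1 j (la,
  la)) = rank (la, la)
    & betas M (j * e) (pc1 j (la, la)) = A j].
  have [] := @psi_comp_Psi psi e M 0 (la, la) j e0 He h1 rM.
  by rewrite /betas addn0.
have PB j := @psi_comp_Psi psi (2 * e) M e (la, la) j e20 H2e h2 rM.
have okA j : bipart_ok (pc1 j (la, la)) by case: (PA j) => h _ _; apply: Phi_ok h.
(* (C) with the odd number [j.*2.+1] concerns one map more, so it yields inclusion at every positive
   even index. *)
have subA j : {subset (A j.+1.*2).1 <= (A j.+1.*2).2}.
  have := @HC e M X j.*2.+1 e0; rewrite /in_P /X size_beta eqxx andbT -/X -/(A _).
  rewrite sorted_beta; last by case/andP: hla.
  by rewrite /= odd_double => /(_ isT isT); rewrite -/(A j.+1.*2); case: (A _).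
have fixA j : {subset (A j).1 <= (A j).2} -> pc1 j.+1 (la, la) = pc1 j (la, la).
  case: (PA j) => h r <- sub; rewrite /pc1 /= add0r -/(pc1 j).
  by apply: (psi_fix e0 (He _) h _ sub); rewrite r.
have AS i : A i.+1 = Psi e (A i) by [].
(* Bicharge [(0, e)] is reached at index 1, the first map only widening [X]. Each map for [2 * e]
   then equals two maps for [e], joined at a positive even index, where (C) applies. *)
have AB j : iter j (Psi (2 * e)) (betas M e (la, la)) = A j.*2.+1.
  elim: j => [|j IH].
    have sX : sorted ltn X by apply: sorted_beta; case/andP: hla.
    rewrite /A /= (@Psi_subset e X X (beta (M + e) la)) //.
      by apply: sorted_beta; case/andP: hla.
    move=> t; rewrite mem_beta_widen //.
    by have := size_part hla; rewrite /M /rank /=; clear; lia.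
  rewrite iterS IH; have := subA j; rewrite doubleS !AS -AS.
  case: (PA j.*2.+1) => _ _ <- sub.
  have /andP[/andP[? _] /andP[? _]] := okA j.*2.+1.
  by rewrite /betas Psi_twice ?size_beta ?leq_addr //; exact: sorted_beta.
have main k : pc2 k.+1 (la, la) = pc1 (2 * k + 2) (la, la).
  have -> : 2 * k + 2 = k.+1.*2 by rewrite doubleS -mul2n addn2.
  (* One more map for [e], the identity by (C), brings both sides to the same bicharge, with second
     entry (2k+3)e, so that their beta sets can be compared. *)
  rewrite -fixA //.
  have [hB rB eB] := PB k.+1; have [hA rA eA] := PA k.+1.*2.+1.
  apply: (@betas_inj M (e + k.+1 * (2 * e))) => //.
  - exact: Phi_ok hB.
  - by rewrite rB ltnW.
  - by rewrite rA ltnW.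
  rewrite eB AB -eA; congr (betas _ _ _).
  by rewrite mulSn -doubleMl -mul2n mulnCA.
split=> [k _|]; first exact: main.
(* From index [K] on, the second entry of the bicharge is at least twice the rank, so [subset_betas]
   makes every further map the identity. *)
set K := (rank (la, la)).*2; have stab j : K <= j -> pc1 j (la, la) = pc1 K (la, la).
  move=> /subnKC <-; elim: (j - K) => [|i IH]; first by rewrite addn0.
  rewrite addnS fixA //; case: (PA (K + i)) => _ r <-.
  apply: subset_betas => //; rewrite r -/K (leq_trans (leq_addr i K)) //.
  by rewrite leq_pmulr.
exists (pc1 K (la, la)); split; last by exists K.
exists K.+1 => -[//|k] Kk; rewrite -/pc2 main; apply: stab.
by move: Kk; clear; lia.
Qed.
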